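(* Let $1 \le p \le \infty$, and let $\Delta \colon S^+_{\operatorname{Lip},p} \to S^+_{\operatorname{Lip},p}$ be a surjective isometry with respect to the norm $\|\cdot\|_{\sigma,p}$. Then there exists an isometric order isomorphism $\mathcal{T} \colon \operatorname{Lip}_{\mathbb{R}}[0,1] \to \operatorname{Lip}_{\mathbb{R}}[0,1]$ such that $\mathcal{T}|_{S^+_{\operatorname{Lip},p}} = \Delta$.
   Context: $\operatorname{Lip}_{\mathbb{R}}[0,1]$ is the real vector space of all Lipschitz continuous real-valued functions on $[0,1]$. Every such $f$ is differentiable almost everywhere with $f' \in L^\infty[0,1]$, and $\|f'\|_\infty$ denotes the essential supremum norm. The norm is $\|f\|_{\sigma,p} = (|f(0)|^p + \|f'\|_\infty^p)^{1/p}$ for $1 \le p < \infty$ and $\|f\|_{\sigma,\infty} = \max\{|f(0)|, \|f'\|_\infty\}$. The order is: $f \le g$ if and only if $f(0) \le g(0)$ and $f' \le g'$ almost everywhere on $[0,1]$. The positive part of the unit sphere is $S^+_{\operatorname{Lip},p} = \{ f \in \operatorname{Lip}_{\mathbb{R}}[0,1] : \|f\|_{\sigma,p} = 1,\ f \ge 0\}$, where $f \ge 0$ refers to this order. A map between subsets of normed spaces is an isometry if it preserves the distances $\|f-g\|$ (no linearity is assumed). An isometric order isomorphism is a surjective real-linear isometry $\mathcal{T}$ such that $\mathcal{T}(f) \le \mathcal{T}(g)$ if and only if $f \le g$. *)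

(* Defs.v *)
From HB Require Import structures.
From mathcomp Require Import all_boot all_order all_algebra.
From mathcomp Require Import all_classical all_reals all_analysis.

Set Implicit Arguments.
Unset Strict Implicit.
Unset Printing Implicit Defensive.

Import Order.TTheory GRing.Theory Num.Theory.
Import numFieldNormedType.Exports.

Local Open Scope classical_set_scope.
Local Open Scope ring_scope.

(* A function on [0, 1] is represented by its extension by 0 to the whole line,
   so that Leibniz equality of representatives is equality on [0, 1]. *)
Definition lipschitz01 (R : realType) : {pred (R -> R)} :=
  mem [set f : R -> R | [lipschitz f x | x in `[0, 1]%classic] /\
                        (forall x : R, x \notin `[0, 1] -> f x = 0)].

Record Lip01 (R : realType) := MkLip01 {
  lip_fun :> R -> R;
  lip_funP : lip_fun \in @lipschitz01 R }.

HB.instance Definition _ (R : realType) := [isSub for @lip_fun R].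
HB.instance Definition _ (R : realType) := [Choice of Lip01 R by <:].

Lemma lipschitz01_submod_closed (R : realType) :
  submod_closed (@lipschitz01 R).
Proof.
have I00 : ((`[0, 1] `*` `[0, 1]) : set (R * R)) (0, 0).
  by split; rewrite /= in_itv/= lexx ler01.
have IF := globally_properfilter I00.
split=> [|a f g /set_mem[lf f0] /set_mem[lg g0]]; apply/mem_set; split => //.
- apply: (@klipschitzW _ _ _ 0) => -[x y] _ /=.
  by rewrite subrr normr0 mul0r.
- have /pinfty_ex_gt0[k k0 kf] := lf.
  have /pinfty_ex_gt0[l l0 lg'] := lg.
  apply: (@klipschitzW _ _ _ (`|a| * k + l)) => -[x y] xy /=.
  rewrite opprD addrACA (le_trans (ler_normD _ _))// mulrDl lerD//.
    by rewrite -scalerBr normrZ -mulrA ler_wpM2l//; exact: (kf (x, y)).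
  exact: (lg' (x, y)).
- move=> x x01; rewrite -[LHS]/(a * f x + g x).
  by rewrite f0// g0// mulr0 addr0.
Qed.

HB.instance Definition _ (R : realType) :=
  GRing.isSubmodClosed.Build R (R -> R) (@lipschitz01 R)
    (lipschitz01_submod_closed R).
HB.instance Definition _ (R : realType) :=
  [SubChoice_isSubLmodule of Lip01 R by <:].

(* [derive1] is total; its values at the points where [f] is not differentiable
   (possibly including 0 and 1, because of the extension by 0) are irrelevant
   below, since these points form a null set within [0, 1]. *)
Definition lip_deriv (R : realType) (f : Lip01 R) : R -> R := derive1 f.

Definition deriv_norm (R : realType) (f : Lip01 R) : R :=
  fine ('N[lebesgue_measure]_+oo
          [EFin \o (lip_deriv f \_ `[0%R, 1%R]%classic)])%E.

Definition lip_norm (R : realType) (p : \bar R) (f : Lip01 R) : R :=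
  match p with
  | r%:E => (`|f 0| `^ r + deriv_norm f `^ r) `^ r^-1
  | +oo%E => Num.max `|f 0| (deriv_norm f)
  | -oo%E => 0 (* junk value *)
  end.

Definition lip_le (R : realType) (f g : Lip01 R) : Prop :=
  f 0 <= g 0 /\
  {ae @lebesgue_measure R, forall x : R,
    x \in `[0, 1] -> lip_deriv f x <= lip_deriv g x}.

Definition pos_sphere (R : realType) (p : \bar R) : set (Lip01 R) :=
  [set f | lip_norm p f = 1 /\ lip_le 0 f].

Definition isometry_on (R : realType) (p : \bar R) (A : set (Lip01 R))
    (F : Lip01 R -> Lip01 R) : Prop :=
  {in A &, forall f g, lip_norm p (F f - F g) = lip_norm p (f - g)}.

Definition isometric_order_isomorphism (R : realType) (p : \bar R)
    (F : {linear Lip01 R -> Lip01 R}) : Prop :=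
  [/\ set_surj [set: Lip01 R] [set: Lip01 R] F,
      isometry_on p [set: Lip01 R] F &
      forall f g, lip_le (F f) (F g) <-> lip_le f g].

(* Main.v *)
Require Import Defs.
From HB Require Import structures.
From mathcomp Require Import all_boot all_order all_algebra.
From mathcomp Require Import all_classical all_reals all_analysis.
From mathcomp Require Import measurable_realfun ess_sup_inf.
From mathcomp Require Import ring lra.

Set Implicit Arguments.
Unset Strict Implicit.
Unset Printing Implicit Defensive.

Import Order.TTheory GRing.Theory Num.Theory.
Import numFieldNormedType.Exports.

Local Open Scope classical_set_scope.
Local Open Scope ring_scope.

(** A function [f] of [Lip01 R] is determined by the pair of the number [f 0]
    and the class of its derivative in L^oo[0, 1], and every pair occurs
    ([lip01_ext], [lip01_primitive]). The theorem is therefore a statement on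
    the p-sum of R and L^oo[0, 1]; it is deduced from the corresponding
    statement for the positive unit sphere S+ of a single space L^oo
    ([plus_sphere_isometry_extension]).

    The latter is proved for measurable functions modulo a filter of conull
    sets. Call two functions of S+ close if their distance is less than 1.
    Closeness alone singles out the indicator functions ([indicator_close],
    [close_indicator]), then the constant 1 among them ([full_close],
    [close_full]), and finally the inclusion of sets modulo null sets, in terms
    of closeness to 1 and to the two indicators ([subae_close]). A surjective
    isometry D of S+ thus maps the indicator of a nonnull set A to the indicator
    of a set Phi A, where Phi is an automorphism of the ordered set of nonnull
    classes.

    The distances from a function g with values in [0, 1] to all indicators
    determine its essential infimum on each set as far as it is at most 1/2,
    and its essential supremum as far as it is at least 1/2
    ([ge_on_dist_indic], [le_on_dist_indic]); this suffices to recover all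
    levels of g, so that the levels of D g are the images under Phi of those of
    g ([transported_of_dist]). Transport of levels along Phi makes sense for
    every essentially bounded function, is unique, and is compatible with sums,
    positive factors, constants and the order: this is the linear extension T.
    It exists because every u in L^oo is C g + b with g in S+, and C (D g) + b
    is its transport.

    For p = +oo the sum of R and L^oo[0, 1] is itself the space L^oo of [0, 1]
    with one more atom, and the result applies to it directly. For finite p the
    function 1, the pair (1, 0), is the only point of the positive sphere at the
    maximal distance 2^(1/p) from more than one point, hence is fixed
    ([Delta_one]); the distance to it determines f 0, so Delta preserves f 0 and
    the norm of the derivative ([Delta_at0], [deriv_norm_Delta]). On the
    functions vanishing at 0, Delta is an isometry of S+ with an extension T as
    above, and the derivative w of Delta f has the same distances to the image
    of S+ as T f', which forces w = T f'.

    The identification with pairs rests on the theorem of Radon and Nikodym: a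
    nondecreasing function g such that x - g x is nondecreasing too has a
    Stieltjes measure dominated by the Lebesgue measure
    ([integral_representation]), and a Lipschitz function is, up to scaling and
    the addition of the identity, of this kind. *)

(** * Essentially bounded functions modulo a filter of conull sets *)

Section essentially_bounded.
Context d (X : measurableType d) (R : realType).
(* [F] is to be thought of as the filter of conull sets of a measure. *)
Variable F : set_system X.
Implicit Types (A B C N : set X) (f g h u v : X -> R) (s c : R).

(** Measurable sets that are not null. *)
Definition nonnull (A : set X) := measurable A /\ ~ F (~` A).

(** Inclusion up to a null set. *)
Definition subae (A B : set X) := F [set x | A x -> B x].

(** [u] is essentially bounded below by [s] on [A]. *)
Definition ge_on (A : set X) (u : X -> R) (s : R) :=
  F [set x | A x -> s <= u x].

(** [u] is essentially bounded above by [s] on [A]. *)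
Definition le_on (A : set X) (u : X -> R) (s : R) :=
  F [set x | A x -> u x <= s].

(** The L^oo distance of [f] and [g] is at most [c]; bounds on the norm are used
    throughout in place of the norm itself. *)
Definition dist_le (f g : X -> R) (c : R) := F [set x | `|f x - g x| <= c].

(** The distance of [f] and [g] is less than 1. *)
Definition close (f g : X -> R) := exists2 c : R, c < 1 & dist_le f g c.

(** Representatives of the elements of L^oo. *)
Definition ess_bounded (u : X -> R) :=
  measurable_fun setT u /\ exists c : R, F [set x | `|u x| <= c].

(** The positive part of the unit sphere of L^oo: the last clause says that the
    essential supremum is at least 1. *)
Definition plus_sphere (g : X -> R) :=
  [/\ measurable_fun setT g, F [set x | 0 <= g x <= 1] &
      forall c : R, F [set x | g x <= c] -> 1 <= c].

(** Equality in L^oo. *)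
Definition eqae (f g : X -> R) := F [set x | f x = g x].

Hypothesis FF : Filter F.
Hypothesis Fcap : forall P : (set X)^nat, (forall n, F (P n)) ->
  F (\bigcap_n P n).

Let aeS := @filterS X F FF.
Let aeS2 := @filterS2 X F FF.
Let aeS3 := @filterS3 X F FF.

Lemma nonnull_ex A P : nonnull A -> F P -> exists x, A x /\ P x.
Proof.
move=> [_ nA] FP; apply: contrapT => nex; apply: nA.
by apply: aeS FP => x Px Ax; apply: nex; exists x.
Qed.

Lemma nonnull_subae A B : nonnull A -> measurable B -> subae A B -> nonnull B.
Proof.
move=> [mA nA] mB AB; split=> // nB; apply: nA.
by apply: aeS2 AB nB => x /= h nBx /h.
Qed.

Lemma subae_trans A B C : subae A B -> subae B C -> subae A C.
Proof. by move=> AB BC; apply: aeS2 AB BC => x /= h k /h/k. Qed.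

Lemma dist_leC f g c : dist_le f g c -> dist_le g f c.
Proof. by apply: aeS => x /=; rewrite distrC. Qed.

Lemma dist_le_eqaer f g h c : eqae g h -> dist_le f g c -> dist_le f h c.
Proof. by move=> gh; apply: aeS2 gh => x /= ->. Qed.

Lemma dist_le_eqael f g h c : eqae g h -> dist_le g f c -> dist_le h f c.
Proof. by move=> gh; apply: aeS2 gh => x /= ->. Qed.

Lemma closeC f g : close f g -> close g f.
Proof. by case=> c c1 /dist_leC ?; exists c. Qed.

Lemma close_eqaer f g h : eqae g h -> close f g -> close f h.
Proof. by move=> gh [c c1 /(dist_le_eqaer gh) ?]; exists c. Qed.

Lemma eqaeC f g : eqae f g -> eqae g f.
Proof. by apply: aeS => x /= ->. Qed.

Lemma eqae_trans f g h : eqae f g -> eqae g h -> eqae f h.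
Proof. by apply: aeS2 => x /= -> ->. Qed.

Lemma measurable_level_lt (u : X -> R) s : measurable_fun setT u ->
  measurable [set x | u x < s].
Proof.
move=> mu; rewrite [X in measurable X](_ : _ = setT `&` u @^-1` `]-oo, s[).
  by apply: mu => //; exact: measurable_itv.
by apply/seteqP; split=> x /=; rewrite in_itv/=; [|case].
Qed.

Lemma measurable_level_ge (u : X -> R) s : measurable_fun setT u ->
  measurable [set x | s <= u x].
Proof.
move=> mu; rewrite [X in measurable X](_ : _ = setT `&` u @^-1` `[s, +oo[).
  by apply: mu => //; exact: measurable_itv.
by apply/seteqP; split=> x /=; rewrite in_itv/= andbT; [|case].
Qed.

Lemma measurable_level_gt (u : X -> R) s : measurable_fun setT u ->
  measurable [set x | s < u x].
Proof.
move=> mu; rewrite [X in measurable X](_ : _ = setT `&` u @^-1` `]s, +oo[).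
  by apply: mu => //; exact: measurable_itv.
by apply/seteqP; split=> x /=; rewrite in_itv/= andbT; [|case].
Qed.

(** If [s] is not a lower bound of [u] on [A], then some smaller [s'] already
    fails on a nonnull set. *)
Lemma not_ge_on A u s : measurable A -> measurable_fun setT u ->
  ~ ge_on A u s -> exists2 s', s' < s & nonnull (A `&` [set x | u x < s']).
Proof.
move=> mA mu nAu; apply: contrapT => nex; apply: nAu.
have h n : F (~` (A `&` [set x | u x < s - n.+1%:R^-1])).
  apply: contrapT => h; apply: nex; exists (s - n.+1%:R^-1).
    by rewrite ltrBlDr ltrDl invr_gt0.
  by split=> //; apply: measurableI => //; exact: measurable_level_lt.
have := Fcap h; apply: aeS => x /= hx Ax.
rewrite leNgt; apply/negP => us.
have [n n0] := ltr_add_invr us.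
by apply: (hx n I); split=> //=; rewrite ltrBrDr.
Qed.

(** A property holds almost everywhere as soon as it does on every nonnull set
    where [u] oscillates by less than [e]. *)
Lemma ess_bounded_grid u (e : R) (P : set X) : ess_bounded u -> 0 < e ->
  (forall A a, nonnull A -> (forall x, A x -> a <= u x < a + e) ->
     F [set x | A x -> P x]) ->
  F P.
Proof.
move=> [mu [c uc]] e0 h.
(* Slices of height [e], starting from the lower bound [- c] of [u]. *)
pose A (n : nat) := [set x | n%:R * e - c <= u x] `&`
                    [set x | u x < n%:R * e - c + e].
have FA n : F [set x | A n x -> P x].
  have [nA|nA] := pselect (F (~` A n)).
    by apply: aeS nA => x /= nAx /nAx.
  apply: (h _ (n%:R * e - c)).
    split=> //; apply: measurableI.
      exact: measurable_level_ge.
    exact: measurable_level_lt.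
  by move=> x [/= -> ->].
apply: aeS2 uc (Fcap FA) => x /= uxc hx.
have uc0 : 0 <= (u x + c) / e.
  apply: divr_ge0; last exact: ltW.
  by move: uxc; rewrite ler_norml => /andP[]; rewrite -subr_ge0 opprK.
apply: (hx (Num.truncn ((u x + c) / e)) I).
have /andP[h1 h2] := truncn_itv uc0.
rewrite /A/=; split.
  by rewrite lerBlDr -ler_pdivlMr.
move: h2; rewrite ltr_pdivrMr// -natr1 mulrDl mul1r => h2.
by rewrite addrAC ltrBrDr.
Qed.

(** Comparing the lower bounds on all nonnull sets compares the functions. *)
Lemma le_of_ge_on u v : ess_bounded u ->
  (forall A s, nonnull A -> ge_on A u s -> ge_on A v s) ->
  F [set x | u x <= v x].
Proof.
move=> bu h.
have he n : F [set x | u x - n.+1%:R^-1 <= v x].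
  apply: (@ess_bounded_grid u n.+1%:R^-1) => //.
  move=> A a nA Aa.
  have : ge_on A v a.
    apply: h => //; apply: aeS (@filterT _ F FF) => x _ /= Ax.
    by have /andP[] := Aa x Ax.
  apply: aeS => x /= av Ax; apply: le_trans (av Ax).
  by have /andP[_ /ltW] := Aa x Ax; rewrite lerBlDr.
apply: aeS (Fcap he) => x /= hx; rewrite leNgt; apply/negP => vu.
have [n n0] := ltr_add_invr vu.
by have := hx n I; rewrite /= lerBlDr leNgt n0.
Qed.

Lemma ess_bounded_itv01 g : measurable_fun setT g ->
  F [set x | 0 <= g x <= 1] -> ess_bounded g.
Proof.
move=> mg g01; split=> //; exists 1; apply: aeS g01 => x /= /andP[g0 g1].
by rewrite ger0_norm.
Qed.

Lemma plus_sphere_bounded g : plus_sphere g -> ess_bounded g.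
Proof. by case=> mg g01 _; exact: ess_bounded_itv01. Qed.

Lemma plus_sphereP g B : measurable_fun setT g -> (forall x, 0 <= g x <= 1) ->
  nonnull B -> (forall x, B x -> g x = 1) -> plus_sphere g.
Proof.
move=> mg g01 nB B1; split=> //.
  by apply: aeS (@filterT _ F FF) => x _ /=.
by move=> c /(nonnull_ex nB)[x [Bx /=]]; rewrite B1.
Qed.

Lemma plus_sphere_level g s : plus_sphere g -> s < 1 ->
  nonnull [set x | s < g x].
Proof.
move=> [mg g01 g1] s1; split; first exact: measurable_level_gt.
move=> h; suff : 1 <= s by rewrite leNgt s1.
by apply: g1; apply: aeS h => x /= /negP; rewrite -leNgt.
Qed.

Lemma indicT (A : set X) x : A x -> \1_A x = 1 :> R.
Proof. by move=> Ax; rewrite indicE mem_set. Qed.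

Lemma indicF (A : set X) x : ~ A x -> \1_A x = 0 :> R.
Proof. by move=> Ax; rewrite indicE memNset. Qed.

Lemma plus_sphere_indic A : nonnull A -> plus_sphere \1_A.
Proof.
move=> nA; apply: (plus_sphereP (B := A)) => //.
- by apply: measurable_indic; case: nA.
- by move=> x; rewrite indicE; case: (_ \in _); rewrite /= ler01 lexx.
- by move=> x Ax; rewrite indicT.
Qed.

(** The function with value 1 on [B], 0 on [N] outside [B] and 1/2 elsewhere. It
    is the test function that detects where another function is 0 or 1. *)
Definition trivalued (B N : set X) (x : X) : R :=
  \1_B x + 2^-1 * \1_(~` (B `|` N)) x.

Lemma trivalued1 B N x : B x -> trivalued B N x = 1.
Proof.
move=> Bx; rewrite /trivalued indicT// indicF ?mulr0 ?addr0//.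
by apply; left.
Qed.

Lemma trivalued0 B N x : ~ B x -> N x -> trivalued B N x = 0.
Proof.
move=> nBx Nx; rewrite /trivalued indicF// indicF ?mulr0 ?addr0//.
by apply; right.
Qed.

Lemma trivalued_half B N x : ~ B x -> ~ N x -> trivalued B N x = 2^-1.
Proof.
move=> nBx nNx; rewrite /trivalued indicF// indicT ?mulr1 ?add0r//.
by case.
Qed.

Lemma plus_sphere_trivalued B N : nonnull B -> measurable N ->
  plus_sphere (trivalued B N).
Proof.
move=> nB mN; apply: (plus_sphereP (B := B)) => //.
- apply: measurable_funD; first by apply: measurable_indic; case: nB.
  apply: measurable_funM => //; apply: measurable_indic.
  by apply: measurableC; apply: measurableU => //; case: nB.
- move=> x; have [Bx|nBx] := pselect (B x).
    by rewrite trivalued1// ler01 lexx.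
  have [Nx|nNx] := pselect (N x).
    by rewrite trivalued0// ler01 lexx.
  by rewrite trivalued_half//; apply/andP; split; lra.
- by move=> x Bx; exact: trivalued1.
Qed.

(** Distances to indicators detect lower bounds up to 1/2: if [g] is at least [s]
    on [A], the witness is the level set where [s <= g]. *)
Lemma ge_on_dist_indic g A s : measurable_fun setT g ->
  F [set x | 0 <= g x <= 1] -> nonnull A -> s <= 2^-1 ->
  ge_on A g s <->
  exists B, [/\ nonnull B, subae A B & dist_le g \1_B (1 - s)].
Proof.
move=> mg g01 nA s2; split=> [As|[B [nB AB gB]]]; last first.
  apply: aeS3 g01 AB gB => x /= /andP[g0 g1] AB + Ax.
  by rewrite indicT; [rewrite ler_norml; lra|exact: AB].
exists [set x | s <= g x].
have sA : subae A [set x | s <= g x] by [].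
split=> //.
  by apply: nonnull_subae sA => //; exact: measurable_level_ge.
apply: aeS g01 => x /= /andP[g0 g1].
have [sg|gs] := leP s (g x).
  by rewrite indicT//= ler_norml; lra.
by rewrite indicF/= ?leNgt ?gs// -leNgt ler_norml; lra.
Qed.

(** Distances to indicators detect upper bounds from 1/2 on: the witness is the
    level set where [s < g], unless it is null. *)
Lemma le_on_dist_indic g A s : measurable_fun setT g ->
  F [set x | 0 <= g x <= 1] -> nonnull A -> 2^-1 <= s ->
  le_on A g s <->
  F [set x | g x <= s] \/
  exists B, [/\ nonnull B, subae A (~` B) & dist_le g \1_B s].
Proof.
move=> mg g01 nA s2; split=> [As|[h|[B [nB AB gB]]]].
- have [h|h] := pselect (F [set x | g x <= s]); [by left|right].
  exists [set x | s < g x]; split.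
  + split; first exact: measurable_level_gt.
    by move=> k; apply: h; apply: aeS k => x /= /negP; rewrite -leNgt.
  + by apply: aeS As => x /= h1 /h1; rewrite leNgt => /negP.
  + apply: aeS g01 => x /= /andP[g0 g1].
    have [sg|gs] := ltP s (g x).
      by rewrite indicT//= ler_norml; lra.
    by rewrite indicF/= ?ltNge ?gs// ler_norml; lra.
- by apply: aeS h => x /= h _.
- apply: aeS3 g01 AB gB => x /= /andP[g0 g1] AB + Ax.
  by rewrite indicF; [rewrite ler_norml; lra|exact: AB].
Qed.

(** * Metric characterisation of indicators and of their order *)

(** If all that is close to [k] is close to the indicator [e], then [k = e]. *)

Lemma indicator_close A e k : nonnull A -> eqae e \1_A -> plus_sphere k ->
  (forall g, plus_sphere g -> close g k -> close g e) -> eqae k e.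
Proof.
move=> nA eA [mk k01 k1] h.
have close1 g : plus_sphere g -> close g k -> close g \1_A.
  by move=> pg /(h _ pg); exact: close_eqaer.
have [mA _] := nA.
(* If [k < s < 1] on a nonnull part [N] of [A], the function equal to 0 on [N]
   and to 1 where [k] is large is close to [k] but not to [\1_A]. *)
have kA : ge_on A k 1.
  apply: contrapT => /(not_ge_on mA mk)[s s1 [mN nN]].
  pose s' := Num.max s 2^-1.
  have s'1 : s' < 1 by rewrite gt_max s1; lra.
  have ss' : s <= s' by rewrite le_max lexx.
  have s'2 : 2^-1 <= s' by rewrite le_max lexx orbT.
  pose N := A `&` [set x | k x < s].
  have nB : nonnull [set x | s' < k x] by exact: plus_sphere_level.
  have := close1 _ (plus_sphere_trivalued nB mN).
  case.
    exists s' => //; apply: aeS k01 => x /= /andP[kx0 kx1].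
    have [Bx|Bx] := ltP s' (k x).
      by rewrite trivalued1//= ler_norml; lra.
    have Bx' : ~ [set x | s' < k x] x by rewrite /= ltNge Bx.
    have [Nx|Nx] := pselect (N x).
      by rewrite trivalued0// ler_norml; lra.
    by rewrite trivalued_half// ler_norml; lra.
  move=> c c1 /(nonnull_ex (conj mN nN))[x [[Ax /= kxs]]].
  rewrite trivalued0//; last by move=> /=; lra.
  by rewrite indicT// sub0r normrN normr1; lra.
(* Likewise if [k] is bounded away from 0 on a nonnull set outside [A], with the
   function equal to 1 there and to 1/2 elsewhere. *)
have kNA : ge_on (~` A) (fun x => - k x) 0.
  have mNk : measurable_fun setT (fun x => - k x) by exact: measurableT_comp.
  apply: contrapT => /(not_ge_on (measurableC mA) mNk)[s s0 nN].
  have [mN _] := nN.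
  have := close1 _ (plus_sphere_trivalued nN (measurable0)).
  case.
    exists (Num.max (1 + s) 2^-1); first by rewrite gt_max; lra.
    apply: aeS k01 => x /= /andP[kx0 kx1]; rewrite le_max.
    have [Nx|Nx] := pselect ((~` A `&` [set x | - k x < s]) x).
      rewrite trivalued1//; apply/orP; left.
      by case: Nx => _ /= ?; rewrite ler_norml; lra.
    rewrite trivalued_half//; apply/orP; right.
    by rewrite ler_norml; lra.
  move=> c c1 /(nonnull_ex nN)[x [[Ax kxs]]] /=.
  rewrite trivalued1// indicF//.
  by rewrite subr0 normr1; lra.
apply: (eqae_trans _ (eqaeC eA)).
apply: aeS3 k01 kA kNA => x /= /andP[kx0 kx1] h1 h2.
have [Ax|Ax] := pselect (A x).
  by rewrite indicT//; apply/eqP; rewrite eq_le kx1 h1.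
by rewrite indicF//; apply/eqP; rewrite eq_le kx0 andbT -oppr_ge0 h2.
Qed.

(** Conversely, a function with values strictly between 0 and 1 on a nonnull set
    can be modified there without losing closeness to any function. *)
Lemma close_indicator e : plus_sphere e ->
  (forall k, plus_sphere k ->
     (forall g, plus_sphere g -> close g k -> close g e) -> eqae k e) ->
  exists2 A, nonnull A & eqae e \1_A.
Proof.
move=> pe h; have [me e01 e1] := pe.
pose t n : R := n.+2%:R^-1.
have t0 n : 0 < t n by rewrite invr_gt0.
have t2 n : t n <= 2^-1 by rewrite lef_pV2 ?posrE// ler_nat.
pose N n := [set x | t n <= e x] `&` [set x | e x < 1 - t n].
have mN n : measurable (N n).
  apply: measurableI; first exact: measurable_level_ge.
  exact: measurable_level_lt.
(* Halving [e] on [N n] gives a function [k] to which the hypothesis applies: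
   on [N n] every [g] is at distance at most [1 - t n] from [e]. *)
have FN n : F (~` N n).
  pose k x := e x * (1 - 2^-1 * \1_(N n) x).
  have kN x : N n x -> k x = e x * 2^-1.
    by move=> Nx; rewrite /k indicT// mulr1; congr (_ * _); lra.
  have kNN x : ~ N n x -> k x = e x.
    by move=> Nx; rewrite /k indicF// mulr0 subr0 mulr1.
  have t0n := t0 n; have t2n := t2 n.
  have pk : plus_sphere k.
    split.
    - apply: measurable_funM => //; apply: measurable_funB => //.
      by apply: measurable_funM => //; exact: measurable_indic.
    - apply: aeS e01 => x /= /andP[e0 e1'].
      have [Nx|Nx] := pselect (N n x).
        by rewrite kN//; lra.
      by rewrite kNN// e0.
    - move=> c kc.
      suff : 1 <= Num.max c (1 - t n).
        by rewrite le_max => /orP[//|]; lra.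
      apply: e1; apply: aeS kc => x /=; rewrite le_max.
      have [Nx _|Nx] := pselect (N n x).
        by case: Nx => _ /= /ltW ->; rewrite orbT.
      by rewrite kNN// => ->.
  have ke : eqae k e.
    apply: h => // g [mg g01 _] [c c1 gk].
    exists (Num.max c (1 - t n)); first by rewrite gt_max c1; lra.
    apply: aeS2 g01 gk => x /= /andP[g0 g1]; rewrite le_max.
    have [Nx _|Nx] := pselect (N n x).
      apply/orP; right; case: Nx => /= ? ?.
      by rewrite ler_norml; lra.
    by rewrite kNN// => ->.
  apply: aeS ke => x /= kex Nx.
  by move: kex; rewrite kN//; case: Nx => /= ? ?; lra.
have e01' : F [set x | e x = 0 \/ e x = 1].
  apply: aeS2 e01 (Fcap FN) => x /= /andP[e0 e1'] hx.
  apply: contrapT => /not_orP[/eqP en0 /eqP en1].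
  have {}e0 : 0 < Num.min (e x) (1 - e x).
    by rewrite lt_min lt_neqAle eq_sym en0 e0/= subr_gt0 lt_neqAle en1 e1'.
  have [n] := ltr_add_invr e0; rewrite add0r lt_min => /andP[n1 n2].
  have tn : t n < n.+1%:R^-1 by rewrite ltf_pV2 ?posrE// ltr_nat.
  apply: (hx n I); split => /=; first exact: ltW (lt_trans tn n1).
  by rewrite ltrBrDr addrC -ltrBrDr (lt_trans tn n2).
exists [set x | 1 <= e x].
  split; first exact: measurable_level_ge.
  move=> h1; suff : 1 <= 0 :> R by rewrite ler10.
  by apply: e1; apply: aeS2 e01' h1 => x /= [->//|->]; rewrite lexx => /(_ isT).
apply: aeS e01' => x /= [ex|ex].
  by rewrite indicF//= ex ler10.
by rewrite indicT//= ex.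
Qed.

(** Among the indicators, only 1 has with every function a common close
    neighbour: the indicators of [A] and of its complement have none. *)
Lemma full_close A e : nonnull A -> eqae e \1_A ->
  (forall f, plus_sphere f -> exists g, [/\ plus_sphere g, close g f & close g e]) ->
  F A.
Proof.
move=> nA eA h; have [mA _] := nA.
have [FA|nFA] := pselect (F A) => //; exfalso.
have nCA : nonnull (~` A) by split; [exact: measurableC|rewrite setCK].
have [g [[_ _ g1] [c c1 gCA]]] := h _ (plus_sphere_indic nCA).
move=> /(close_eqaer eA)[c' c'1 gA].
have : 1 <= Num.max c c'; last by rewrite le_max; lra.
apply: g1; apply: aeS2 gCA gA => x /=.
have [Ax|Ax] := pselect (A x).
  rewrite (indicF (A := ~` A)); last by move=> k; exact: (k Ax).
  by rewrite subr0 le_max => /(le_trans (ler_norm _)) ->.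
rewrite (indicF (A := A))// subr0 le_max => _ /(le_trans (ler_norm _)) ->.
by rewrite orbT.
Qed.

(** The constant 1 and [f] have the close neighbour [max f (1/2)]. *)
Lemma close_full e f : eqae e (cst 1) -> plus_sphere f ->
  exists g, [/\ plus_sphere g, close g f & close g e].
Proof.
move=> e1 [mf f01 f1].
exists (fun x => Num.max (f x) 2^-1); split.
- split.
  + by apply: measurable_maxr.
  + apply: aeS f01 => x /= /andP[f0 f1'].
    by rewrite le_max f0 /= ge_max f1' invf_le1// ler1n.
  + by move=> c h; apply: f1; apply: aeS h => x /=; rewrite ge_max => /andP[].
- exists 2^-1; first by rewrite invf_lt1// ltr1n.
  apply: aeS f01 => x /= /andP[f0 f1'].
  by case: (leP (f x) 2^-1) => ?; rewrite ler_norml; lra.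
- apply: (close_eqaer (eqaeC e1)); exists 2^-1; first by rewrite invf_lt1// ltr1n.
  apply: aeS f01 => x /= /andP[f0 f1'].
  by case: (leP (f x) 2^-1) => ?; rewrite ler_norml; lra.
Qed.

(** Inclusion of sets, read off closeness; if a nonnull part of [A] lies outside
    [B], the function equal to 1 on [A] and 1/2 elsewhere is a counterexample. *)
Lemma subae_close A B : nonnull A -> nonnull B ->
  subae A B <->
  (forall g, plus_sphere g -> close g (cst 1) -> close g \1_A ->
                   close g \1_B).
Proof.
move=> nA nB; split=> [AB g _ [c c1 g1] [c' c'1 gA]|h].
  exists (Num.max c c'); first by rewrite gt_max c1.
  apply: aeS3 AB g1 gA => x /= ABx; rewrite le_max.
  have [Bx|Bx] := pselect (B x).
    by rewrite (indicT (A := B))// => ->.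
  have Ax : ~ A x by move/ABx.
  by rewrite !indicF// => _ ->; rewrite orbT.
apply: contrapT => AB.
have [mA _] := nA; have [mB _] := nB.
have nD : nonnull (A `\` B).
  split; first exact: measurableD.
  move=> hD; apply: AB; apply: aeS hD => x /= hx Ax.
  by apply: contrapT => Bx; apply: hx.
have half1 : 2^-1 < 1 :> R by rewrite invf_lt1// ltr1n.
have := h _ (plus_sphere_trivalued nA measurable0).
case.
- exists 2^-1 => //; apply: aeS (@filterT _ F FF) => x _ /=.
  have [Ax|Ax] := pselect (A x); first by rewrite trivalued1// ler_norml; lra.
  by rewrite trivalued_half// ler_norml; lra.
- exists 2^-1 => //; apply: aeS (@filterT _ F FF) => x _ /=.
  have [Ax|Ax] := pselect (A x).
    by rewrite trivalued1// indicT// ler_norml; lra.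
  by rewrite trivalued_half// indicF// ler_norml; lra.
- move=> c c1 /(nonnull_ex nD)[x [[Ax Bx]]] /=.
  by rewrite trivalued1// indicF// subr0 normr1; lra.
Qed.

End essentially_bounded.

(** * Transport of the levels of a function along an automorphism *)

Section transport_of_level_sets.
Context d (X : measurableType d) (R : realType).
Variable F : set_system X.
Implicit Types (A B C N : set X) (f g h u v w : X -> R) (s c : R).
Hypothesis FF : Filter F.
Hypothesis Fcap : forall P : (set X)^nat, (forall n, F (P n)) ->
  F (\bigcap_n P n).

Let aeS := @filterS X F FF.
Let aeS2 := @filterS2 X F FF.
Let aeS3 := @filterS3 X F FF.
Let aeI := @filterI X F FF.

Variable Phi : set X -> set X.

(** [Phi] induces an automorphism of the ordered set of nonnull measurable sets
    modulo null sets. *)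
Definition order_automorphism :=
  [/\ forall A, nonnull F A -> nonnull F (Phi A),
      forall A B, nonnull F A -> nonnull F B ->
        subae F A B <-> subae F (Phi A) (Phi B) &
      forall B, nonnull F B ->
        exists A, [/\ nonnull F A, subae F (Phi A) B & subae F B (Phi A)]].

Hypothesis Phi_auto : order_automorphism.

Let Phi_nonnull A : nonnull F A -> nonnull F (Phi A).
Proof. by case: Phi_auto => + _ _; exact. Qed.

Let Phi_subae A B : nonnull F A -> nonnull F B ->
  subae F A B <-> subae F (Phi A) (Phi B).
Proof. by case: Phi_auto => _ + _; exact. Qed.

Let Phi_mono A B : nonnull F A -> nonnull F B ->
  subae F A B -> subae F (Phi A) (Phi B).
Proof. by move=> nA nB /(Phi_subae nA nB). Qed.

Let Phi_cancel A B : nonnull F A -> nonnull F B ->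
  subae F (Phi A) (Phi B) -> subae F A B.
Proof. by move=> nA nB /(Phi_subae nA nB). Qed.

Let Phi_surj B : nonnull F B ->
  exists A, [/\ nonnull F A, subae F (Phi A) B & subae F B (Phi A)].
Proof. by case: Phi_auto => _ _; exact. Qed.

Lemma ge_on_subae A B u s : subae F A B -> ge_on F B u s -> ge_on F A u s.
Proof. by move=> AB; apply: aeS2 AB => x /= h + /h. Qed.

Lemma le_on_subae A B u s : subae F A B -> le_on F B u s -> le_on F A u s.
Proof. by move=> AB; apply: aeS2 AB => x /= h + /h. Qed.

(** Disjointness modulo null sets in terms of the order on nonnull sets. *)
Lemma subae_disjoint A B : nonnull F A -> nonnull F B ->
  subae F A (~` B) <->
  forall C, nonnull F C -> subae F C A -> ~ subae F C B.
Proof.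
move=> [mA nA] [mB nB]; split=> [AB C nC CA CB|h].
  have [x [Cx [hA hB]]] := nonnull_ex FF nC
    (aeI (subae_trans FF CA AB) CB).
  by apply: (hA Cx); exact: hB.
apply: contrapT => AB.
have nI : nonnull F (A `&` B).
  split; first exact: measurableI.
  by move=> k; apply: AB; apply: aeS k => x /= k Ax Bx; apply: k.
by apply: (h _ nI); apply: aeS (@filterT _ F FF) => x _ /= [].
Qed.

Lemma Phi_disjoint A B : nonnull F A -> nonnull F B ->
  subae F A (~` B) <-> subae F (Phi A) (~` Phi B).
Proof.
move=> nA nB; rewrite !subae_disjoint//; try exact: Phi_nonnull.
split=> h C nC CA CB.
  have [C' [nC' h1 h2]] := Phi_surj nC.
  apply: (h C' nC').
    by apply: Phi_cancel => //; exact: (subae_trans FF h1 CA).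
  by apply: Phi_cancel => //; exact: (subae_trans FF h1 CB).
apply: (h (Phi C)); first exact: Phi_nonnull.
- exact: Phi_mono.
- exact: Phi_mono.
Qed.

(** Lower bounds above [s0] in terms of upper bounds that are at least [s0]. *)
Lemma ge_on_le_on A u s s0 : measurable A -> measurable_fun setT u -> s0 < s ->
  ge_on F A u s <->
  forall B s', nonnull F B -> subae F B A -> s0 <= s' < s -> ~ le_on F B u s'.
Proof.
move=> mA mu s0s; split=> [h B s' nB BA /andP[_ s's] h'|h].
  have [x [Bx [/= h1 h2]]] := nonnull_ex FF nB
    (aeI (ge_on_subae BA h) h').
  by move: (h1 Bx) (h2 Bx); lra.
apply: contrapT => /(not_ge_on FF Fcap mA mu)[s' s's nB].
have ss : s0 <= Num.max s0 s' < s by rewrite le_max lexx/= gt_max s0s.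
apply: (h _ _ nB _ ss); first by apply: aeS (@filterT _ F FF) => x _ /= [].
by apply: aeS (@filterT _ F FF) => x _ /= [_ /ltW]; rewrite le_max orbC => ->.
Qed.

(** The essential lower bounds of [v] on [Phi A] are those of [u] on [A], for all
    nonnull [A]. *)
Definition transported u v :=
  forall A s, nonnull F A -> ge_on F A u s <-> ge_on F (Phi A) v s.

(** Functions with values in [0, 1], the same essential supremum and the same
    distances to corresponding indicators have corresponding levels. *)
Lemma transported_of_dist g h :
  measurable_fun setT g -> F [set x | 0 <= g x <= 1] ->
  measurable_fun setT h -> F [set x | 0 <= h x <= 1] ->
  (forall c, F [set x | g x <= c] <-> F [set x | h x <= c]) ->
  (forall B c, nonnull F B ->
     dist_le F g \1_B c <-> dist_le F h \1_(Phi B) c) ->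
  transported g h.
Proof.
move=> mg g01 mh h01 gh dgh.
have dist_sub B B' c : nonnull F B -> subae F B B' -> subae F B' B ->
    dist_le F h \1_B' c -> dist_le F h \1_B c.
  move=> nB h1 h2; apply: dist_le_eqaer; apply: aeS2 h1 h2 => x /= h1 h2.
  have [Bx|Bx] := pselect (B x); first by rewrite !indicT//; exact: h1.
  by rewrite !indicF// => /h2.
have low A s : nonnull F A -> s <= 2^-1 ->
    ge_on F A g s <-> ge_on F (Phi A) h s.
  move=> nA s2; have nPA := Phi_nonnull nA.
  rewrite !ge_on_dist_indic//; split=> [[B [nB AB dB]]|[B [nB AB dB]]].
    exists (Phi B); split; [exact: Phi_nonnull|exact: Phi_mono|exact/dgh].
  have [C [nC CB BC]] := Phi_surj nB.
  exists C; split => //; first by apply: Phi_cancel => //; exact: (subae_trans FF AB BC).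
  by apply/dgh => //; apply: dist_sub dB => //; exact: Phi_nonnull.
have high A s : nonnull F A -> 2^-1 <= s ->
    le_on F A g s <-> le_on F (Phi A) h s.
  move=> nA s2; have nPA := Phi_nonnull nA.
  rewrite !le_on_dist_indic//; split=> [[/gh|[B [nB AB dB]]]|[/gh|[B [nB AB dB]]]].
  - by left.
  - right; exists (Phi B); split;
      [exact: Phi_nonnull|exact: (Phi_disjoint nA nB).1|exact/dgh].
  - by left.
  have [C [nC CB BC]] := Phi_surj nB.
  right; exists C; split => //.
    apply: (Phi_disjoint nA nC).2; apply: aeS2 AB CB => x /= h1 h2 /h1 + /h2.
    exact.
  by apply/dgh => //; apply: dist_sub dB => //; exact: Phi_nonnull.
move=> A s nA; have nPA := Phi_nonnull nA.
have [s2|s2] := leP s 2^-1; first exact: low.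
rewrite (ge_on_le_on (nA.1) mg s2) (ge_on_le_on (nPA.1) mh s2).
split=> k B s' nB BA /[dup] ss' /andP[s2' _] l.
  have [C [nC CB BC]] := Phi_surj nB.
  apply: (k C s' nC) => //.
    by apply: Phi_cancel => //; exact: (subae_trans FF CB BA).
  by apply/high => //; exact: le_on_subae l.
by apply: (k (Phi B) s') => //; [exact: Phi_nonnull|exact: Phi_mono|exact/high].
Qed.

Lemma transported_le u v u' v' : ess_bounded F u -> ess_bounded F v ->
  transported u v -> transported u' v' ->
  F [set x | u x <= u' x] <-> F [set x | v x <= v' x].
Proof.
move=> bu bv uv uv'; split=> h.
  apply: (le_of_ge_on FF Fcap bv) => B s nB vB.
  have [A [nA AB BA]] := Phi_surj nB.
  apply: ge_on_subae BA _; apply/uv' => //.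
  have : ge_on F A u s by apply/uv => //; exact: ge_on_subae vB.
  by apply: aeS2 h => x /= h1 + Ax => /(_ Ax) /le_trans; exact.
apply: (le_of_ge_on FF Fcap bu) => A s nA uA.
apply/uv' => //.
have : ge_on F (Phi A) v s by apply/uv.
by apply: aeS2 h => x /= h1 + Ax => /(_ Ax) /le_trans; exact.
Qed.

Lemma transported_unique u v w : ess_bounded F v -> ess_bounded F w ->
  ess_bounded F u ->
  transported u v -> transported u w -> eqae F v w.
Proof.
move=> bv bw bu uv uw.
have uu : F [set x | u x <= u x] by apply: aeS (@filterT _ F FF) => x _ /=.
have h1 := (transported_le bu bv uv uw).1 uu.
have h2 := (transported_le bu bw uw uv).1 uu.
by apply: aeS2 h1 h2 => x /= h1 h2; apply/eqP; rewrite eq_le h1.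
Qed.

Lemma transported_scale u v c : 0 < c -> transported u v ->
  transported (fun x => c * u x) (fun x => c * v x).
Proof.
move=> c0 uv A s nA.
have E B w : ge_on F B (fun x => c * w x) s <-> ge_on F B w (s / c).
  by split; apply: aeS => x /= h /h; rewrite ler_pdivrMr// mulrC.
by rewrite !E; exact: uv.
Qed.

Lemma transported_shift u v k : transported u v ->
  transported (fun x => u x + k) (fun x => v x + k).
Proof.
move=> uv A s nA.
have E B w : ge_on F B (fun x => w x + k) s <-> ge_on F B w (s - k).
  by split; apply: aeS => x /= h /h; rewrite lerBlDr.
by rewrite !E; exact: uv.
Qed.

Lemma ge_on_cst A c s : nonnull F A -> ge_on F A (cst c) s <-> s <= c.
Proof.
move=> nA; split=> [/(nonnull_ex FF nA)[x [Ax]]|h]; first exact.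
by apply: aeS (@filterT _ F FF) => x _ /=.
Qed.

Lemma transported_cst c : transported (cst c) (cst c).
Proof.
by move=> A s nA; rewrite !ge_on_cst//; exact: Phi_nonnull.
Qed.

(** Lower bounds of a sum in terms of those of the summands: every nonnull part
    of [A] contains a smaller one where [u] is almost constant. *)
Lemma ge_onD A u v s : ess_bounded F u -> measurable_fun setT v -> nonnull F A ->
  ge_on F A (u \+ v) s <->
  forall e B, 0 < e -> nonnull F B -> subae F B A ->
    exists C a b, [/\ nonnull F C, subae F C B, ge_on F C u a, ge_on F C v b &
                      s - e <= a + b].
Proof.
move=> bu mv nA; have [mu _] := bu; split=> [h e B e0 nB BA|h].
  apply: contrapT => nex; case: nB => mB; apply.
  apply: (ess_bounded_grid FF Fcap bu e0) => C a nC Ca.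
  have [//|nCB] := pselect (F [set x | C x -> (~` B) x]).
  have nI : nonnull F (C `&` B).
    split; first by apply: measurableI => //; case: nC.
    by move=> k; apply: nCB; apply: aeS k => x /= k Cx Bx; apply: k.
  exfalso; apply: nex; exists (C `&` B), a, (s - e - a); split => //.
  - by apply: aeS (@filterT _ F FF) => x _ /= [].
  - by apply: aeS (@filterT _ F FF) => x _ /= [/Ca/andP[]].
  - apply: aeS2 h BA => x /= h BA [/Ca/andP[_ ua] /BA/h].
    by move: ua; lra.
  - by lra.
apply: contrapT => /(not_ge_on FF Fcap nA.1)[|s' s's nB].
  exact: measurable_funD.
have e0 : 0 < (s - s') / 2 by lra.
have BA : subae F (A `&` [set x | (u \+ v) x < s']) A.
  by apply: aeS (@filterT _ F FF) => x _ /= [].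
have [C [a [b [nC CB Cu Cv sab]]]] := h _ _ e0 nB BA.
have [x [Cx [/= CBx [Cux Cvx]]]] := nonnull_ex FF nC (aeI CB (aeI Cu Cv)).
by have [_ /=] := CBx Cx; move: (Cux Cx) (Cvx Cx); lra.
Qed.

Lemma transportedD u v u' v' : ess_bounded F u -> ess_bounded F v ->
  ess_bounded F u' -> ess_bounded F v' ->
  transported u v -> transported u' v' -> transported (u \+ u') (v \+ v').
Proof.
move=> bu bv bu' bv' uv uv' A s nA; have nPA := Phi_nonnull nA.
rewrite !ge_onD//; [|by case: bv'|by case: bu'].
split=> h e B e0 nB BA.
  have [B' [nB' B'B BB']] := Phi_surj nB.
  have B'A : subae F B' A by apply: Phi_cancel => //; exact: (subae_trans FF B'B BA).
  have [C [a [b [nC CB Ca Cb sab]]]] := h _ _ e0 nB' B'A.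
  exists (Phi C), a, b; split => //; [exact: Phi_nonnull| |exact/uv|exact/uv'].
  exact: (subae_trans FF (Phi_mono nC nB' CB) B'B).
have PBA : subae F (Phi B) (Phi A) by exact: Phi_mono.
have [C [a [b [nC CB Ca Cb sab]]]] := h _ _ e0 (Phi_nonnull nB) PBA.
have [C' [nC' C'C CC']] := Phi_surj nC.
exists C', a, b; split => //.
- by apply: Phi_cancel => //; exact: (subae_trans FF C'C CB).
- by apply/uv => //; exact: ge_on_subae Ca.
- by apply/uv' => //; exact: ge_on_subae Cb.
Qed.

End transport_of_level_sets.

(** * Extension of surjective isometries of the positive sphere of L^oo *)

Section plus_sphere_isometry.
Context d (X : measurableType d) (R : realType).
Variable F : set_system X.
Implicit Types (A B C N : set X) (e f g h k u v w : X -> R) (s c : R).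
Hypothesis FF : Filter F.
Hypothesis Fcap : forall P : (set X)^nat, (forall n, F (P n)) ->
  F (\bigcap_n P n).
Hypothesis F0 : ~ F set0.

Let aeS := @filterS X F FF.
Let aeS2 := @filterS2 X F FF.
Let aeS3 := @filterS3 X F FF.
Let aeT := @filterT X F FF.

(* [D] acts on representatives; it respects [eqae] by [D_isom] with [c = 0]. *)
Variable D : (X -> R) -> (X -> R).
Hypothesis D_fun : forall g, plus_sphere F g -> plus_sphere F (D g).
Hypothesis D_surj : forall h, plus_sphere F h ->
  exists2 g, plus_sphere F g & eqae F (D g) h.
Hypothesis D_isom : forall f g c, plus_sphere F f -> plus_sphere F g ->
  dist_le F f g c <-> dist_le F (D f) (D g) c.

Let close_D f g : plus_sphere F f -> plus_sphere F g ->
  close F f g <-> close F (D f) (D g).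
Proof. by move=> pf pg; split=> -[c c1 /(D_isom _ pf pg) fg]; exists c. Qed.

Let close_DV f g : plus_sphere F f -> plus_sphere F g ->
  close F (D f) (D g) -> close F f g.
Proof. by move=> pf pg /(close_D pf pg). Qed.

Lemma eqae_dist_le f g : eqae F f g <-> dist_le F f g 0.
Proof.
split; apply: aeS => x /=; first by move=> ->; rewrite subrr normr0.
by rewrite normr_le0 subr_eq0 => /eqP.
Qed.

Let eqae_D f g : plus_sphere F f -> plus_sphere F g ->
  eqae F f g <-> eqae F (D f) (D g).
Proof. by move=> pf pg; rewrite !eqae_dist_le; exact: D_isom. Qed.

Let eqae_DV f g : plus_sphere F f -> plus_sphere F g ->
  eqae F (D f) (D g) -> eqae F f g.
Proof. by move=> pf pg /(eqae_D pf pg). Qed.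

Let D_indicator A : nonnull F A ->
  exists B, nonnull F B /\ eqae F (D \1_A) \1_B.
Proof.
move=> nA; have pA := plus_sphere_indic R FF nA.
have [|B nB DB] := close_indicator FF Fcap (D_fun pA); last by exists B.
move=> k' pk' h.
have [k pk Dk] := D_surj pk'.
apply: (eqae_trans FF (eqaeC FF Dk)); apply: (eqae_D pk pA).1.
have h1 : eqae F \1_A (\1_A : X -> R) by apply: aeS aeT => x _ /=.
apply: (indicator_close FF Fcap nA h1 pk) => g pg gk.
apply: close_DV => //; apply: h; first exact: D_fun.
by apply: (close_eqaer FF Dk); exact: (close_D pg pk).1.
Qed.

Let D_indicator_inv B : nonnull F B ->
  exists2 A, nonnull F A & eqae F (D \1_A) \1_B.
Proof.
move=> nB; have [g pg DB] := D_surj (plus_sphere_indic R FF nB).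
have [|A nA gA] := close_indicator FF Fcap pg.
  move=> k pk h; apply: eqae_DV => //.
  apply: (eqae_trans FF _ (eqaeC FF DB)).
  have h1 : eqae F \1_B (\1_B : X -> R) by apply: aeS aeT => x _ /=.
  apply: (indicator_close FF Fcap nB h1 (D_fun pk)) => f' pf' fk.
  have [f pf Df] := D_surj pf'.
  apply: (closeC FF); apply: (close_eqaer FF Df); apply: (closeC FF).
  apply: (close_eqaer FF DB).
  apply: (close_D pf pg).1; apply: h => //; apply: close_DV => //.
  apply: (closeC FF); apply: (close_eqaer FF (eqaeC FF Df)).
  exact: (closeC FF).
exists A => //; apply: (eqae_trans FF _ DB); apply: (eqae_D _ pg).1.
- exact: plus_sphere_indic.
- exact: eqaeC.
Qed.

Let D_one : eqae F (D (cst 1)) (cst 1).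
Proof.
have nT : nonnull F [set: X] by split=> //; rewrite setCT.
have ET : \1_[set: X] = cst 1 :> (X -> R) by apply/funext => x; rewrite indicT.
have pT := plus_sphere_indic R FF nT.
have [B [nB DB]] := D_indicator nT.
rewrite ET in pT DB.
have FB : F B.
  apply: (full_close FF nB DB) => f' pf'.
  have [f pf Df] := D_surj pf'.
  have [|g [pg gf g1]] := close_full FF _ pf (e := cst 1).
    by apply: aeS aeT => x _ /=.
  exists (D g); split; first exact: D_fun.
    by apply: (close_eqaer FF Df); exact: (close_D pg pf).1.
  exact: (close_D pg pT).1.
by apply: aeS2 DB FB => x /= -> Bx; rewrite indicT.
Qed.

Let one_sphere : plus_sphere F (cst 1 : X -> R).
Proof.
split=> //; first by apply: aeS aeT => x _ /=; rewrite ler01 lexx.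
move=> c h; rewrite leNgt; apply/negP => c1; apply: F0.
by apply: aeS h => x /=; rewrite leNgt c1.
Qed.

Let eqae_subae A B : eqae F (\1_A) (\1_B : X -> R) -> subae F A B.
Proof.
apply: aeS => x /= + Ax; rewrite indicT// => h.
by apply: contrapT => Bx; move: h; rewrite indicF// => /eqP; rewrite oner_eq0.
Qed.

Let ex_Phi : exists Phi, forall A, nonnull F A ->
  nonnull F (Phi A) /\ eqae F (D \1_A) \1_(Phi A).
Proof.
suff : forall A, exists B, nonnull F A -> nonnull F B /\ eqae F (D \1_A) \1_B.
  by move=> h; have [Phi hPhi] := choice h; exists Phi.
move=> A; have [/D_indicator[B ?]|nA] := pselect (nonnull F A); first by exists B.
by exists set0 => /nA.
Qed.

Let Phi_automorphism Phi :
  (forall A, nonnull F A ->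
     nonnull F (Phi A) /\ eqae F (D \1_A) \1_(Phi A)) ->
  order_automorphism F Phi.
Proof.
move=> hPhi; split=> [A /hPhi[]//|A B nA nB|B nB].
  have [nPA DA] := hPhi _ nA; have [nPB DB] := hPhi _ nB.
  have pA := plus_sphere_indic R FF nA.
  have pB := plus_sphere_indic R FF nB.
  rewrite (subae_close R FF nA nB) (subae_close R FF nPA nPB).
  split=> [h g' pg' g'1 g'A|h g pg g1 gA].
    have [g pg Dg] := D_surj pg'.
    have tr f f' : eqae F (D f) f' -> plus_sphere F f ->
        close F g' f' <-> close F g f.
      move=> ff' pf; rewrite (close_D pg pf).
      split=> k.
        apply: (closeC FF); apply: (close_eqaer FF (eqaeC FF Dg)).
        apply: (closeC FF); apply: (close_eqaer FF (eqaeC FF ff')) k.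
      apply: (closeC FF); apply: (close_eqaer FF Dg).
      by apply: (closeC FF); apply: (close_eqaer FF ff') k.
    by apply/(tr _ _ DB pB); apply: h => //; [exact/(tr _ _ D_one)|exact/(tr _ _ DA)].
  have tr f f' : eqae F (D f) f' -> plus_sphere F f ->
      close F g f <-> close F (D g) f'.
    move=> ff' pf; rewrite (close_D pg pf).
    split; first exact: (close_eqaer FF ff').
    exact: (close_eqaer FF (eqaeC FF ff')).
  apply/(tr _ _ DB pB); apply: h; first exact: D_fun.
    exact/(tr _ _ D_one).
  exact/(tr _ _ DA).
have [A nA DA] := D_indicator_inv nB.
have [nPA DPA] := hPhi _ nA.
exists A; split => //; apply: eqae_subae.
  exact: (eqae_trans FF (eqaeC FF DPA) DA).
exact: (eqae_trans FF (eqaeC FF DA) DPA).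
Qed.

Lemma ess_bounded_affine u a b : ess_bounded F u ->
  ess_bounded F (fun x => a * u x + b).
Proof.
move=> [mu [c uc]]; split.
  by apply: measurable_funD => //; exact: measurable_funM.
exists (`|a| * c + `|b|); apply: aeS uc => x /= uc.
by rewrite (le_trans (ler_normD _ _))// lerD2r normrM ler_wpM2l.
Qed.

Lemma ess_bounded_scale u a : ess_bounded F u ->
  ess_bounded F (fun x => a * u x).
Proof.
move=> bu; have := ess_bounded_affine a 0 bu; congr ess_bounded.
by apply/funext => x; rewrite addr0.
Qed.

Lemma ess_boundedD u v : ess_bounded F u -> ess_bounded F v ->
  ess_bounded F (u \+ v).
Proof.
move=> [mu [c uc]] [mv [c' vc]]; split; first exact: measurable_funD.
exists (c + c'); apply: aeS2 uc vc => x /= uc vc.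
by rewrite (le_trans (ler_normD _ _))// lerD.
Qed.

(** Every essentially bounded function is an affine image of a positive function
    of norm 1. *)
Lemma ess_bounded_normalize u : ess_bounded F u ->
  exists (C b : R) g, [/\ 0 < C, plus_sphere F g & u = (fun x => C * g x + b)].
Proof.
move=> [mu [c uc]].
pose E : set R := [set a | F [set x | u x + c + 1 <= a]].
have E1 a : E a -> 1 <= a.
  move=> Ea; rewrite leNgt; apply/negP => a1; apply: F0.
  apply: aeS2 Ea uc => x /= h; rewrite ler_norml; lra.
have hasE : has_inf E.
  split; last by exists 1 => a /E1.
  exists (c + c + 1); apply: aeS uc => x /=; rewrite ler_norml; lra.
pose C := inf E.
have C1 : 1 <= C by apply: lb_le_inf; [case: hasE|move=> a /E1].
have EC : E C.
  have EN n : F [set x | u x + c + 1 <= C + n.+1%:R^-1].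
    have [a Ea aC] := @inf_adherent _ E n.+1%:R^-1 ltac:(by rewrite invr_gt0) hasE.
    by apply: aeS Ea => x /= h; apply: (le_trans h); exact: ltW.
  apply: aeS (Fcap EN) => x /= hx; rewrite leNgt; apply/negP => Cx.
  have [n n0] := ltr_add_invr Cx.
  by have := hx n I; rewrite /= leNgt n0.
have C0 : 0 < C by lra.
(* [C] is the essential supremum of [u + c + 1], which is at least 1. *)
exists C, (- (c + 1)), (fun x => C^-1 * u x + C^-1 * (c + 1)); split=> //.
- split.
  + by apply: measurable_funD => //; exact: measurable_funM.
  + apply: aeS2 EC uc => x /= h1; rewrite ler_norml => h2.
    rewrite -mulrDr mulr_ge0 ?invr_ge0; [|lra|lra].
    by rewrite mulrC ler_pdivrMr// mul1r addrA.
  + move=> a h; have : E (a * C).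
      apply: aeS h => x /=; rewrite -mulrDr mulrC ler_pdivrMr// addrA.
      by [].
    move=> Ea; have : C <= a * C.
      by apply: ge_inf => //; case: hasE.
    by rewrite ler_pMl.
- apply/funext => x; rewrite mulrDr !mulrA divff ?gt_eqF// !mul1r addrK//.
Qed.

(** [T] acts on representatives of L^oo and is linear, bijective, bipositive and
    isometric there. The last clause identifies [T u] inside the unit ball, not
    only on the sphere, by its norm and its distances to the image of [D]. *)
Theorem plus_sphere_isometry_extension :
  exists T : (X -> R) -> (X -> R),
  [/\ forall u, ess_bounded F u -> ess_bounded F (T u),
      forall u v, ess_bounded F u -> ess_bounded F v -> eqae F u v ->
        eqae F (T u) (T v),
      forall u v, ess_bounded F u -> ess_bounded F v ->
        eqae F (T (u \+ v)) (T u \+ T v),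
      forall c u, ess_bounded F u ->
        eqae F (T (fun x => c * u x)) (fun x => c * T u x) &
      [/\ forall g, plus_sphere F g -> eqae F (T g) (D g),
        forall v, ess_bounded F v ->
        exists2 u, ess_bounded F u & eqae F (T u) v,
      forall u v, ess_bounded F u -> ess_bounded F v ->
        F [set x | u x <= v x] <-> F [set x | T u x <= T v x],
      forall u c, ess_bounded F u ->
        F [set x | `|u x| <= c] <-> F [set x | `|T u x| <= c] &
      forall u w,
        measurable_fun setT u -> F [set x | 0 <= u x <= 1] ->
        measurable_fun setT w -> F [set x | 0 <= w x <= 1] ->
        (forall c, F [set x | u x <= c] <-> F [set x | w x <= c]) ->
        (forall g c, plus_sphere F g ->
           dist_le F u g c <-> dist_le F w (D g) c) ->
        eqae F (T u) w]].
Proof.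
have [Phi hPhi] := ex_Phi.
have aut := Phi_automorphism hPhi.
have tr_dist u w :
    measurable_fun setT u -> F [set x | 0 <= u x <= 1] ->
    measurable_fun setT w -> F [set x | 0 <= w x <= 1] ->
    (forall c, F [set x | u x <= c] <-> F [set x | w x <= c]) ->
    (forall g c, plus_sphere F g ->
       dist_le F u g c <-> dist_le F w (D g) c) ->
    transported F Phi u w.
  move=> mu u01 mw w01 uw duw.
  apply: (transported_of_dist FF Fcap aut) => // B c nB.
  have [nPB DB] := hPhi _ nB.
  rewrite (duw _ _ (plus_sphere_indic R FF nB)).
  by split; apply: (dist_le_eqaer FF) => //; exact: eqaeC.
have tr_D g : plus_sphere F g -> transported F Phi g (D g).
  move=> pg; have [mg g01 g1] := pg; have [mDg Dg01 Dg1] := D_fun pg.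
  apply: tr_dist => //; last by move=> f c pf; exact: D_isom.
  have key f c : plus_sphere F f -> F [set x | f x <= c] <-> 1 <= c.
    move=> [_ f01 f1]; split; first exact: f1.
    by move=> c1; apply: aeS f01 => x /= /andP[_ /le_trans]; exact.
  by move=> c; rewrite !key//; exact: D_fun.
have ex_tr u : ess_bounded F u ->
    exists2 v, ess_bounded F v & transported F Phi u v.
  move=> /ess_bounded_normalize[C [b [g [C0 pg ->]]]].
  exists (fun x => C * D g x + b).
    by apply: ess_bounded_affine; apply: (plus_sphere_bounded FF); exact: D_fun.
  by apply: transported_shift => //; apply: transported_scale => //; exact: tr_D.
have ex_tr_inv v : ess_bounded F v -> exists u v',
    [/\ ess_bounded F u, ess_bounded F v', eqae F v' v & transported F Phi u v'].
  move=> /ess_bounded_normalize[C [b [h [C0 ph ->]]]].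
  have [g pg Dg] := D_surj ph.
  exists (fun x => C * g x + b), (fun x => C * D g x + b); split.
  - by apply: ess_bounded_affine; exact: (plus_sphere_bounded FF).
  - by apply: ess_bounded_affine; apply: (plus_sphere_bounded FF); exact: D_fun.
  - by apply: aeS Dg => x /= ->.
  - by apply: transported_shift => //; apply: transported_scale => //; exact: tr_D.
(* [T u] is the transport of [u]; its value is irrelevant if [u] is not
   essentially bounded. *)
have /choice[T hT] u : exists v, ess_bounded F u ->
    ess_bounded F v /\ transported F Phi u v.
  have [/ex_tr[v bv uv]|nu] := pselect (ess_bounded F u); first by exists v.
  by exists u.
have bT u : ess_bounded F u -> ess_bounded F (T u) by move=> /hT[].
have tT u : ess_bounded F u -> transported F Phi u (T u) by move=> /hT[].
have uniq u w : ess_bounded F u -> ess_bounded F w -> transported F Phi u w ->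
    eqae F (T u) w.
  by move=> bu bw uw; apply: (transported_unique FF Fcap aut _ _ bu) => //;
    [exact: bT|exact: tT].
have bcst c : ess_bounded F (cst c).
  by split=> //; exists `|c|; apply: aeS aeT => x _ /=.
have TD u v : ess_bounded F u -> ess_bounded F v ->
    eqae F (T (u \+ v)) (T u \+ T v).
  move=> bu bv; have ? := bT _ bu; have ? := bT _ bv.
  apply: uniq; [exact: ess_boundedD|exact: ess_boundedD|].
  by apply: (transportedD FF Fcap aut) => //; exact: tT.
have Tcst c : eqae F (T (cst c)) (cst c).
  by apply: uniq => //; exact: (transported_cst FF aut).
have Tpos c u : 0 < c -> ess_bounded F u ->
    eqae F (T (fun x => c * u x)) (fun x => c * T u x).
  move=> c0 bu; apply: uniq; [exact: ess_bounded_scale|exact/ess_bounded_scale/bT|].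
  by apply: (transported_scale FF) => //; exact: tT.
have Tle u v : ess_bounded F u -> ess_bounded F v ->
    F [set x | u x <= v x] <-> F [set x | T u x <= T v x].
  move=> bu bv; apply: (transported_le FF Fcap aut) => //;
    [exact: bT|exact: tT|exact: tT].
exists T; split => //; last split => //.
- move=> u v bu bv uv.
  have h1 : F [set x | T u x <= T v x].
    by apply: (Tle _ _ bu bv).1; apply: aeS uv => x /= ->.
  have h2 : F [set x | T v x <= T u x].
    by apply: (Tle _ _ bv bu).1; apply: aeS uv => x /= ->.
  by apply: aeS2 h1 h2 => x /= h1 h2; apply/eqP; rewrite eq_le h1.
- move=> c u bu.
  have [c0|c0|<-] := ltgtP 0 c; first exact: Tpos.
    have := TD _ _ (ess_bounded_scale c bu) (ess_bounded_scale (- c) bu).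
    rewrite (_ : _ \+ _ = cst 0); last first.
      by apply/funext => x; rewrite /= mulNr subrr.
    (* For [c < 0], use [T (c u) + T (- c u) = T 0 = 0]. *)
    have c0' : 0 < - c by rewrite oppr_gt0.
    move: (Tcst 0) (Tpos _ _ c0' bu); apply: aeS3 => x /= -> ->.
    by lra.
  have := Tcst 0; rewrite (_ : cst 0 = (fun x => 0 * u x)).
    by apply: aeS => x /= ->; rewrite !mul0r.
  by apply/funext => x; rewrite mul0r.
- move=> g pg; apply: uniq; [exact: (plus_sphere_bounded FF)| |exact: tr_D].
  by apply: (plus_sphere_bounded FF); exact: D_fun.
- move=> v bv; have [u [v' [bu bv' v'v uv']]] := ex_tr_inv v bv.
  exists u => //; apply: (eqae_trans FF _ v'v); exact: uniq.
- move=> u c bu.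
  have E w : F [set x | `|w x| <= c] <->
      F [set x | cst (- c) x <= w x] /\ F [set x | w x <= cst c x].
    split=> [h|[h1 h2]].
      by split; apply: aeS h => x /=; rewrite ler_norml => /andP[].
    by apply: aeS2 h1 h2 => x /= h1 h2; rewrite ler_norml h1.
  rewrite !E (Tle _ _ (bcst (- c)) bu) (Tle _ _ bu (bcst c)).
  split=> -[h1 h2]; split.
  + by apply: aeS2 h1 (Tcst (- c)) => x /= h3 h4; move: h3; rewrite h4.
  + by apply: aeS2 h2 (Tcst c) => x /= h3 h4; move: h3; rewrite h4.
  + by apply: aeS2 h1 (Tcst (- c)) => x /= h3 h4; move: h3; rewrite h4.
  + by apply: aeS2 h2 (Tcst c) => x /= h3 h4; move: h3; rewrite h4.
- move=> u w mu u01 mw w01 uw duw; apply: uniq.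
  + exact: ess_bounded_itv01.
  + exact: ess_bounded_itv01.
  + exact: tr_dist.
Qed.

End plus_sphere_isometry.

(** * Lipschitz functions as integrals *)

Section stieltjes_density.
Context (R : realType).
Notation mu := (@lebesgue_measure R).

Lemma cumulative_of (g : R -> R) : {homo g : x y / x <= y} -> continuous g ->
  exists G : cumulative R R, G = g :> (R -> R).
Proof.
move=> gnd gc.
pose M := isCumulative.Build R _ R g gnd (right_continuousW gc).
by exists (HB.pack_for (cumulative R R) g M).
Qed.

Lemma lebesgue_stieltjes_measure_itvoc (G : cumulative R R) (a b : R) :
  a <= b -> lebesgue_stieltjes_measure G `]a, b]%classic = (G b - G a)%:E.
Proof.
move=> ab; rewrite /lebesgue_stieltjes_measure/= /measure_extension/=.
by rewrite measurable_mu_extE/= ?wlength_itv_bnd//; exact: is_ocitv.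
Qed.

(** If [g] and [h x = x - g x] are nondecreasing and continuous, their Stieltjes
    measures add up to the Lebesgue measure, which therefore dominates that of
    [g]; [q] is the density of the latter on ]0, 1]. *)
Lemma integral_representation (g h : R -> R) :
  {homo g : x y / x <= y} -> {homo h : x y / x <= y} ->
  continuous g -> continuous h -> (forall x, g x + h x = x) ->
  exists q : R -> R, mu.-integrable setT (EFin \o q) /\
    forall x, 0 <= x <= 1 -> \int[mu]_(t in `]0, x]) q t = g x - g 0.
Proof.
move=> gnd hnd gc hc gh.
have [G Gg] := cumulative_of gnd gc.
have [H Hh] := cumulative_of hnd hc.
pose mG : {measure set (measurableTypeR R) -> \bar R} := lebesgue_stieltjes_measure G.
pose mH : {measure set (measurableTypeR R) -> \bar R} := lebesgue_stieltjes_measure H.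
have muGH A : measurable A -> mu A = (mG A + mH A)%E.
  move=> mA; rewrite -measure_addE; apply: lebesgue_measure_unique => //.
  move=> _ [[a b] _ <-] /=.
  rewrite -[RHS]/(measure_add mG mH `]a, b]%classic) measure_addE.
  have [ab|ba] := leP a b; last first.
    by rewrite set_itv_ge ?measure0 ?adde0// bnd_simp -leNgt ltW.
  rewrite lebesgue_measure_itv/= lte_fin.
  rewrite /mG /mH !lebesgue_stieltjes_measure_itvoc// Gg Hh.
  have -> : ((g b - g a)%:E + (h b - h a)%:E = (b - a)%:E)%E.
    by rewrite -EFinD -[in RHS](gh b) -[in RHS](gh a); congr EFin; ring.
  by case: ltP => // ba; rewrite (@le_anti _ _ a b) ?ab// subrr.
have GD A : measurable A -> (mG A <= mu A)%E.
  by move=> mA; rewrite muGH// leeDl.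
have mI : measurable (`]0, 1]%classic : set (measurableTypeR R)).
  exact: measurable_itv.
have fI : (mG `]0%R, 1%R]%classic < +oo)%E.
  rewrite (_ : mG _ = (G 1%R - G 0%R)%:E) ?ltry//.
  exact: lebesgue_stieltjes_measure_itvoc.
pose nu := mfrestr mI fI.
have numu : nu `<< mu.
  apply/null_content_dominatesP => A mA A0; apply/eqP.
  rewrite eq_le measure_ge0 andbT /nu /mfrestr /mrestr -A0.
  apply: le_trans (GD _ mA); apply: le_measure; rewrite ?inE//.
  exact: measurableI.
have [f [f0 ffin fint fE]] := radon_nikodym_sigma_finite numu.
have fq : EFin \o (fine \o f) = f by apply/funext => x /=; rewrite fineK.
exists (fine \o f); split; first by rewrite fq.
move=> x /andP[x0 x1]; rewrite /Rintegral.
under eq_integral do rewrite fineK//.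
rewrite -fE; last exact: measurable_itv.
rewrite -[X in fine X]/(mG (`]0%R, x]%classic `&` `]0%R, 1%R]%classic)).
rewrite setIidl; last by apply: subset_itvl; rewrite bnd_simp.
rewrite (_ : mG _ = (G x - G 0)%:E); first by rewrite Gg.
exact: lebesgue_stieltjes_measure_itvoc.
Qed.

End stieltjes_density.

Section lipschitz_functions.
Context (R : realType).
Notation mu := (@lebesgue_measure R).
Implicit Types (f : Lip01 R) (x y : R).

Let ae01 := @ae_filter_ringOfSetsType _ (measurableTypeR R) R mu.

Lemma lip01P f : exists2 K : R, 0 < K &
  forall x y, x \in `[0, 1] -> y \in `[0, 1] -> `|f x - f y| <= K * `|x - y|.
Proof.
have [/pinfty_ex_gt0[K K0 Kf] _] := set_mem (lip_funP f).
by exists K => // x y x01 y01; exact: (Kf (x, y)).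
Qed.

Lemma lip01_out f x : x \notin `[0, 1] -> f x = 0.
Proof. by have [_] := set_mem (lip_funP f); exact. Qed.

Lemma nonexpansive_continuous (g : R -> R) :
  (forall x y, `|g x - g y| <= `|x - y|) -> continuous g.
Proof.
move=> gl x; apply/(@cvgrPdist_le _ R^o) => e e0.
near=> y; apply: (le_trans (gl _ _)).
near: y.
have /(@cvgrPdist_le _ R^o) := @cvg_id _ (nbhs x).
exact.
Unshelve. all: by end_near. Qed.

Lemma ae_itv01 (P : set R) : {ae mu, forall x, 0 < x < 1 -> P x} ->
  {ae mu, forall x, x \in `[0, 1] -> P x}.
Proof.
have neq a : {ae mu, forall x : R, x <> a}.
  exists [set a]; split=> //; first exact: lebesgue_measure_set1.
  by move=> x /= /contrapT.
move: (neq 0) (neq 1); apply: (@filterS3 _ _ ae01) => x /= x0 x1 h.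
rewrite in_itv/= => /andP[]; rewrite !le_eqVlt => /predU1P[/esym//|{}x0].
by move=> /predU1P[//|{}x1]; apply: h; rewrite x0.
Qed.

Lemma ae_derivable_primitive (w : R -> R) : mu.-integrable setT (EFin \o w) ->
  {ae mu, forall x : R, 0 < x ->
    is_derive x 1 (fun y => \int[mu]_(t in `]0, y]) w t) (w x)}.
Proof.
move=> iw.
have h : {ae mu, forall x : R, (BRight 0 < BRight x)%O ->
    derivable (fun y => \int[mu]_(t in `]0, y]) w t) x 1 /\
    derive1 (fun y => \int[mu]_(t in `]0, y]) w t) x = w x}.
  apply: (@FTC1 R w (BRight 0)).
    by move=> y; apply: integrableS iw.
  by apply: open_integrable_locally => //; exact: openT.
apply: (@filterS _ _ ae01) h => x /= h x0.
have [|h1 h2] := h; first by rewrite bnd_simp.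
by rewrite -h2 derive1E; exact/derivableP.
Qed.

(** The nearest point projection onto [0, 1]. *)
Definition clamp01 (x : R) := Num.max 0 (Num.min x 1).

Lemma clamp01_itv x : clamp01 x \in `[0, 1].
Proof.
by rewrite in_itv/= /clamp01 le_max lexx/= ge_max ler01 ge_min lexx orbT.
Qed.

Lemma clamp01_id x : x \in `[0, 1] -> clamp01 x = x.
Proof.
rewrite in_itv/= => /andP[x0 x1].
by rewrite /clamp01 (min_idPl x1) (max_idPr x0).
Qed.

Lemma clamp01_dist x y : `|clamp01 x - clamp01 y| <= `|x - y|.
Proof.
have le_clamp a : clamp01 a = if a <= 0 then 0 else if a <= 1 then a else 1.
  rewrite /clamp01; have [a1|a1] := leP a 1.
    by case: (leP a 0).
  by rewrite (max_idPr ler01) leNgt (lt_trans ltr01 a1).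
rewrite !le_clamp; have := ler_norm (x - y); have := ler_norm (- (x - y)).
rewrite normrN; move: `|x - y| => r h1 h2.
by rewrite ler_norml; case: (leP x 0) => ?; case: (leP y 0) => ?;
  case: (leP x 1) => ?; case: (leP y 1) => ?; lra.
Qed.

(** For [K] a Lipschitz constant of [f], the functions [(x + f x / K) / 2] and
    [(x - f x / K) / 2] are nondecreasing with sum [x]; [q] is the density of the
    first one. *)
Lemma lip01_representation f : exists (K : R) (q : R -> R),
  [/\ 0 < K, mu.-integrable setT (EFin \o q) &
     forall x, x \in `[0, 1] ->
       f x = f 0 + K * (2 * (\int[mu]_(t in `]0, x]) q t) - x)].
Proof.
have [K K0 fK] := lip01P f.
pose p x := K^-1 * f (clamp01 x).
have pl x y : `|p x - p y| <= `|x - y|.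
  rewrite /p -mulrBr normrM gtr0_norm ?invr_gt0// ler_pdivrMl//.
  apply: (le_trans (fK _ _ (clamp01_itv x) (clamp01_itv y))).
  by rewrite ler_pM2l// clamp01_dist.
pose g x := 2^-1 * (x + p x); pose h x := 2^-1 * (x - p x).
have gnd : {homo g : x y / x <= y}.
  move=> x y xy; rewrite /g ler_pM2l ?invr_gt0//.
  have := pl x y; rewrite (ler0_norm (_ : x - y <= 0)) ?subr_le0//.
  by rewrite ler_norml; lra.
have hnd : {homo h : x y / x <= y}.
  move=> x y xy; rewrite /h ler_pM2l ?invr_gt0//.
  have := pl x y; rewrite (ler0_norm (_ : x - y <= 0)) ?subr_le0//.
  by rewrite ler_norml; lra.
have lipc k : (forall x, k x = 2^-1 * (x + p x)) \/
    (forall x, k x = 2^-1 * (x - p x)) -> continuous k.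
  move=> kE; apply: nonexpansive_continuous => x y.
  have := pl x y; case: kE => kE; rewrite !kE !ler_norml.
    by case: (ger0P (x - y)) => ?; lra.
  by case: (ger0P (x - y)) => ?; lra.
have gc : continuous g by apply: lipc; left.
have hc : continuous h by apply: lipc; right.
have gh x : g x + h x = x by rewrite /g /h; lra.
have [q [iq qE]] := integral_representation gnd hnd gc hc gh.
exists K, q; split => // x x01.
have /qE -> : 0 <= x <= 1 by move: x01; rewrite in_itv.
have c0 : clamp01 0 = 0 by rewrite clamp01_id// in_itv/= lexx ler01.
rewrite /g /p c0 clamp01_id//.
have -> : 2 * (2^-1 * (x + K^-1 * f x) - 2^-1 * (0 + K^-1 * f 0)) - x =
   K^-1 * (f x - f 0) by rewrite mulrBr; lra.
by rewrite mulrA divff ?gt_eqF// mul1r addrC subrK.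
Qed.

(** Rademacher's theorem in dimension 1: almost everywhere the derivative exists
    and equals the measurable function [K (2 q - 1)]. *)
Lemma lip01_ae_derivable f : exists (K : R) (q : R -> R),
  [/\ 0 < K, mu.-integrable setT (EFin \o q),
     forall x, x \in `[0, 1] ->
       f x = f 0 + K * (2 * (\int[mu]_(t in `]0, x]) q t) - x) &
     {ae mu, forall x, x \in `[0, 1] ->
       is_derive x (1 : R) f (K * (2 * q x - 1))}].
Proof.
have [K [q [K0 iq fE]]] := lip01_representation f.
exists K, q; split => //.
apply: ae_itv01; move: (ae_derivable_primitive iq).
apply: (@filterS _ _ ae01) => x /= dq /andP[x0 x1].
have {}dq := dq x0.
apply: (@near_eq_is_derive _ _ _
  (fun y => f 0 + K * (2 * (\int[mu]_(t in `]0, y]) q t) - y))).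
  near=> y; rewrite -fE//; apply: subset_itv_oo_cc.
  by near: y; apply: near_in_itvoo; rewrite in_itv/= x0 x1.
set Q := fun y => _ in dq *.
have d1 : is_derive x (1 : R) (2 *: Q : R -> R^o) (2 *: (q x : R^o)).
  exact: is_deriveZ.
have d2 : is_derive x (1 : R) ((2 *: Q : R -> R^o) - id) (2 *: (q x : R^o) - 1).
  exact: is_deriveB.
have d3 := is_deriveZ K d2.
have d4 := is_deriveD (is_derive_cst (f 0 : R^o) x (1 : R)) d3.
by move: d4; rewrite add0r.
Unshelve. all: by end_near. Qed.

End lipschitz_functions.

Section lipschitz_derivative.
Context (R : realType).
Notation mu := (@lebesgue_measure R).
Implicit Types (f g : Lip01 R) (x y : R).

Let ae01 := @ae_filter_ringOfSetsType _ (measurableTypeR R) R mu.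

Lemma lip01_inj f g : f =1 g -> f = g.
Proof. by move=> fg; apply: val_inj; apply/funext. Qed.

Lemma lip_deriv_derivable f :
  {ae mu, forall x, x \in `[0, 1] -> derivable f x (1 : R)}.
Proof.
have [K [q [_ _ _]]] := lip01_ae_derivable f.
by apply: (@filterS _ _ ae01) => x /= df /df[].
Qed.

Lemma lip_deriv_measurable f : exists2 w : R -> R, measurable_fun setT w &
  {ae mu, forall x, x \in `[0, 1] -> lip_deriv f x = w x}.
Proof.
have [K [q [_ iq _ df]]] := lip01_ae_derivable f.
exists (fun x => K * (2 * q x - 1)).
  apply: measurable_funM => //; apply: measurable_funB => //.
  apply: measurable_funM => //.
  by have /measurable_int/measurable_EFinP := iq.
apply: (@filterS _ _ ae01) df => x /= df /df[_ <-].
by rewrite /lip_deriv derive1E.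
Qed.

Lemma lip_deriv_bounded f : exists K : R,
  {ae mu, forall x, x \in `[0, 1] -> `|lip_deriv f x| <= K}.
Proof.
have [K K0 fK] := lip01P f; exists K.
have h : {ae mu, forall x : R, 0 < x < 1 -> x \in `[0, 1] ->
    `|lip_deriv f x| <= K}.
  apply: (@filterS _ _ ae01) (lip_deriv_derivable f) => x /= df x01 x01'.
  have {}df := df x01'.
  rewrite /lip_deriv derive1E.
  have /cvg_norm : h^-1 *: (f (h *: (1 : R) + x) - f x) @[h --> 0^'] -->
      'D_1 (f : R -> R) x by exact: df.
  apply: (@closed_cvg _ _ _ _ _ [set y : R | y <= K]).
    exact: closed_le.
  near=> h.
  have h0 : h != 0 by near: h; exact: nbhs_dnbhs_neq.
  rewrite /= normrM normfV ler_pdivrMl ?normr_gt0// mulrC.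
  have hE : h = h *: (1 : R) + x - x by rewrite addrK /GRing.scale/= mulr1.
  rewrite [X in K * `|X|]hE.
  apply: fK => //; apply: subset_itv_oo_cc; near: h.
  have x0 : h *: (1 : R) + x @[h --> 0^'] --> x.
    rewrite -[X in _ --> X]add0r; apply: cvgD; last exact: cvg_cst.
    rewrite -[X in _ --> X](mul0r (1 : R)); apply: cvgM; last exact: cvg_cst.
    exact: cvg_within.
  have /near_in_itvoo : x \in `]0, 1[ by rewrite in_itv.
  by move/x0.
apply: (@filterS _ _ ae01) (ae_itv01 h) => x /= k x01.
exact: k.
Unshelve. all: by end_near. Qed.

Lemma lip_deriv_linear a f g : {ae mu, forall x, x \in `[0, 1] ->
  lip_deriv (a *: f + g) x = a * lip_deriv f x + lip_deriv g x}.
Proof.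
move: (lip_deriv_derivable f) (lip_deriv_derivable g).
apply: (@filterS2 _ _ ae01) => x /= df dg x01.
rewrite /lip_deriv !derive1E.
rewrite -[X in 'D_1 X x]/(a *: (f : R -> R^o) + (g : R -> R^o)).
rewrite deriveD; [|by apply: derivableZ; exact: df|exact: dg].
by rewrite deriveZ//; exact: df.
Qed.

(** If the derivative vanishes almost everywhere, then [q = 1/2] in the integral
    representation of [f]. *)
Lemma lip01_eq0 f : f 0 = 0 ->
  {ae mu, forall x, x \in `[0, 1] -> lip_deriv f x = 0} -> f = 0.
Proof.
move=> f0 df0; have [K [q [K0 iq fE df]]] := lip01_ae_derivable f.
apply: lip01_inj => x; have [x01|/lip01_out ->//] := boolP (x \in `[0, 1]).
have /andP[x0 x1] : 0 <= x <= 1 by move: x01; rewrite in_itv.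
rewrite fE// f0 add0r.
have -> : \int[mu]_(t in `]0, x]) q t = \int[mu]_(t in `]0, x]) 2^-1.
  rewrite /Rintegral; congr fine; apply: ae_eq_integral => //.
  - by have /measurable_int := iq; exact: measurable_funTS.
  - move: df df0; apply: (@filterS2 _ _ ae01) => t /= h1 h2.
    rewrite in_itv/= => /andP[t0 tx].
    have t01 : t \in `[0, 1] by rewrite in_itv/= ltW//= (le_trans tx).
    have [_] := h1 t01; rewrite -derive1E => h3.
    move: (h2 t01); rewrite /lip_deriv h3 => /eqP.
    rewrite mulf_eq0 gt_eqF//= => /eqP h4; congr EFin; lra.
rewrite Rintegral_cst//= lebesgue_measure_itv/= lte_fin.
rewrite -[RHS](mulr0 K); congr (_ * _).
move: x0; rewrite le_eqVlt => /predU1P[<-|x0].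
  by rewrite ltxx/= !mulr0 subrr.
by rewrite x0/= subr0 mulrA divff ?mul1r ?subrr.
Qed.

Lemma lip01_ext f g : f 0 = g 0 ->
  {ae mu, forall x, x \in `[0, 1] -> lip_deriv f x = lip_deriv g x} -> f = g.
Proof.
move=> fg dfg; suff : (-1) *: g + f = 0.
  by rewrite scaleN1r addrC => /eqP; rewrite subr_eq0 => /eqP.
apply: lip01_eq0.
  by rewrite -[LHS]/(-1 * g 0 + f 0) fg mulN1r addNr.
move: dfg (lip_deriv_linear (-1) g f); apply: (@filterS2 _ _ ae01).
by move=> x /= h1 h2 x01; rewrite h2// h1// mulN1r addNr.
Qed.

(** Every measurable, essentially bounded [w] is a derivative. *)
Lemma lip01_primitive (a : R) (w : R -> R) (K : R) : measurable_fun setT w ->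
  {ae mu, forall x, x \in `[0, 1] -> `|w x| <= K} ->
  exists f, f 0 = a /\
    {ae mu, forall x, x \in `[0, 1] -> lip_deriv f x = w x}.
Proof.
move=> mw wK.
(* Truncation turns the essential bound on [w] into a bound everywhere. *)
pose w0 x := Num.max (- `|K|) (Num.min `|K| (w x)).
have w0K x : `|w0 x| <= `|K|.
  rewrite ler_norml /w0 le_max lexx/= ge_max ge_min lexx/= andbT.
  by have := normr_ge0 K; lra.
have mw0 : measurable_fun setT w0.
  by apply: measurable_maxr => //; exact: measurable_minr.
pose I01 : set R := `[0, 1]%classic.
pose w1 := w0 \_ I01.
have w1K x : `|w1 x| <= `|K|.
  by rewrite /w1 patchE; case: ifP => // _; rewrite normr0.
have muI : (mu I01 < +oo)%E.
  by rewrite /I01 lebesgue_measure_itv/= lte_fin ltr01 -EFinB ltry.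
have iw : mu.-integrable setT (EFin \o w1).
  rewrite -restrict_EFin -integrable_mkcond//; last exact: measurable_itv.
  apply: measurable_bounded_integrable; first exact: measurable_itv.
  - exact: muI.
  - exact: measurable_funTS.
  - exists `|K|; split; first by rewrite num_real.
    by move=> M KM x _ /=; rewrite (le_trans (w0K x))// ltW.
pose W x := \int[mu]_(t in `]0, x]) w1 t.
have iwS A : measurable A -> mu.-integrable A (EFin \o w1).
  by move=> mA; exact: integrableS iw.
have WL x y : 0 <= x -> x <= y -> `|W y - W x| <= `|K| * (y - x).
  move=> x0 xy; rewrite /W.
  rewrite (@Rintegral_itvB _ _ (BRight 0) (BRight y) x) ?bnd_simp//; last first.
    by apply: iwS; exact: measurable_itv.
  have iI : mu.-integrable `]x, y]%classic (EFin \o w1).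
    by apply: iwS; exact: measurable_itv.
  apply: (le_trans (le_normr_Rintegral _ iI)); first exact: measurable_itv.
  have -> : `|K| * (y - x) = \int[mu]_(t in `]x, y]) `|K|.
    rewrite Rintegral_cst; last exact: measurable_itv.
    congr (_ * _); suff : mu `]x, y]%classic = (y - x)%:E by move=> /(congr1 fine).
    rewrite lebesgue_measure_itv/= lte_fin -EFinB.
    by case: ltP => // yx; rewrite (@le_anti _ _ x y) ?xy// subrr.
  apply: le_Rintegral.
  - exact: measurable_itv.
  - by have := integrable_norm iI.
  - apply: measurable_bounded_integrable; first exact: measurable_itv.
    + have : (mu `]x, y]%classic < +oo)%E; last exact.
      by rewrite lebesgue_measure_itv/=; case: ifP => _; rewrite -?EFinB ltry.
    + exact: measurable_cst.
    + exists `|K|; split; first by rewrite num_real.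
      by move=> M KM t _ /=; rewrite normr_id ltW.
  - by move=> t _.
pose F x := if x \in `[0, 1] then a + W x else 0.
have FP : F \in @lipschitz01 R.
  apply/mem_set; split; last by move=> x /negbTE; rewrite /F => ->.
  have I00 : ((`[0, 1] `*` `[0, 1]) : set (R * R)) (0, 0).
    by split; rewrite /= in_itv/= lexx ler01.
  have IF := globally_properfilter I00.
  apply: (@klipschitzW _ _ _ `|K|) => -[x y] /= [x01 y01].
  rewrite /F x01 y01 opprD addrACA subrr add0r.
  wlog xy : x y x01 y01 / y <= x.
    move=> hw; have [/hw|/ltW xy] := leP y x; first exact.
    by rewrite distrC (distrC x) hw.
  rewrite (ger0_norm (_ : 0 <= x - y)) ?subr_ge0//; apply: WL => //.
  by move: y01; rewrite in_itv/= => /andP[].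
exists (MkLip01 FP); split.
  rewrite /= /F in_itv/= lexx ler01 /W set_itv_ge ?bnd_simp ?ltxx//.
  by rewrite Rintegral_set0 addr0.
have h : {ae mu, forall x, 0 < x < 1 -> x \in `[0, 1] ->
    lip_deriv (MkLip01 FP) x = w x}.
  move: wK (ae_derivable_primitive iw); apply: (@filterS2 _ _ ae01).
  move=> x /= wKx dW /andP[x0 x1] x01; rewrite /lip_deriv derive1E.
  have dW1 : is_derive x (1 : R) (cst a + W : R -> R^o) (0 + w1 x).
    by apply: is_deriveD; exact: dW.
  rewrite (@near_eq_derive _ _ _ _ (cst a + W : R -> R^o)).
    rewrite derive_val add0r /w1 patchE mem_set//.
    rewrite /w0 min_r ?max_r//.
      have := wKx x01; rewrite ler_norml => /andP[/(le_trans _)->//].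
      by rewrite lerN2 ler_norm.
    by apply: (le_trans (ler_norm _)); apply: (le_trans (wKx x01)); rewrite ler_norm.
  near=> y; rewrite /= /F ifT//; apply: subset_itv_oo_cc.
  by near: y; apply: near_in_itvoo; rewrite in_itv/= x0 x1.
by apply: (@filterS _ _ ae01) (ae_itv01 h) => x /= k x01; exact: k.
Unshelve. all: by end_near. Qed.

Lemma deriv_norm_ge0 f : 0 <= deriv_norm f.
Proof. by rewrite /deriv_norm; apply: fine_ge0; exact: Lnorm_ge0. Qed.

Lemma deriv_norm_le f c : 0 <= c ->
  deriv_norm f <= c <->
  {ae mu, forall x, x \in `[0, 1] -> `|lip_deriv f x| <= c}.
Proof.
move=> c0.
pose I01 : set R := `[0, 1]%classic.
pose h : R -> \bar R := EFin \o (lip_deriv f \_ I01).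
have hE (b : R) : 0 <= b -> {ae mu, forall x, ((abse \o h) x <= b%:E)%E} <->
    {ae mu, forall x, x \in `[0, 1] -> `|lip_deriv f x| <= b}.
  move=> b0; split; apply: (@filterS _ _ ae01) => x /=.
    rewrite /h/= lee_fin patchE => + x01.
    by rewrite mem_set.
  move=> k; rewrite /h/= lee_fin patchE; case: ifPn => [/set_mem/k//|_].
  by rewrite normr0.
have NE : ('N[mu]_+oo [h] = ess_sup mu (abse \o h))%E.
  rewrite unlock /Lnorm ifT//.
  have : (0 < mu [set: R])%E; last exact.
  by rewrite -set_itvNyy lebesgue_measure_itv lt0y.
have fin : 'N[mu]_+oo [h]%E \is a fin_num.
  rewrite ge0_fin_numE ?Lnorm_ge0// NE.
  have [K fK] := lip_deriv_bounded f.
  apply: (@le_lt_trans _ _ (`|K|)%:E); last by rewrite ltry.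
  apply/ess_supP; apply/(hE `|K|) => //.
  by apply: (@filterS _ _ ae01) fK => x /= k /k /le_trans; apply; exact: ler_norm.
rewrite /deriv_norm -/h -lee_fin fineK// NE -(hE c)//.
by split=> /ess_supP.
Qed.

End lipschitz_derivative.

(** * Derivatives as elements of L^oo *)

Section unit_interval_filters.
Context (R : realType).
Notation mu := (@lebesgue_measure R).
Notation X := (measurableTypeR R).
Implicit Types (f g : Lip01 R) (u v : X -> R).

(** The sets containing almost every point of [0, 1]. *)
Definition ae_unit : set_system X :=
  fun P => {ae mu, forall x : R, x \in `[0, 1] -> P x}.

(** The conull sets of the Lebesgue measure on [0, 1] plus an atom at -1; any
    point outside [0, 1] would do. *)
Definition ae_unit_atom : set_system X := fun P => ae_unit P /\ P (-1).

Let aeF := @ae_filter_ringOfSetsType _ X R mu.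

Lemma ae_unit_filter : Filter ae_unit.
Proof.
split.
- by apply: (@filterS _ _ aeF) (@filterT _ _ aeF) => x _ /=.
- move=> P Q; apply: (@filterS2 _ _ aeF) => x /= h k x01.
  by split; [exact: h|exact: k].
- by move=> P Q PQ; apply: (@filterS _ _ aeF) => x /= h /h/PQ.
Qed.

Lemma ae_unit_bigcap (P : (set X)^nat) :
  (forall n, ae_unit (P n)) -> ae_unit (\bigcap_n P n).
Proof.
move=> h; have : mu.-negligible
    (\bigcup_n ~` [set x : X | (x : R) \in `[0, 1] -> P n x]).
  by apply: negligible_bigcup => n; exact: h.
apply: negligibleS => x /= k; apply: contrapT => nex; apply: k => x01 n _.
by apply: contrapT => nP; apply: nex; exists n => //= /(_ x01).
Qed.

Lemma ae_unit_itv (a b : R) : 0 <= a -> a < b -> b <= 1 ->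
  ~ ae_unit (~` `[a, b]%classic).
Proof.
rewrite /ae_unit /almost_everywhere => a0 ab b1 h.
have : mu.-negligible (`[a, b]%classic : set R).
  apply: negligibleS h => x /= xab /(_ _ xab); apply.
  by move: xab; rewrite !in_itv/= => /andP[/(le_trans a0)-> /le_trans->].
move=> [A [mA A0 IA]].
have : (mu `[a, b]%classic <= 0)%E.
  by rewrite -A0; apply: le_measure; rewrite ?inE//; exact: measurable_itv.
by rewrite lebesgue_measure_itv/= lte_fin ab -EFinB lee_fin subr_le0 leNgt ab.
Qed.

Lemma ae_unit_proper : ~ ae_unit set0.
Proof.
move=> h; apply: (@ae_unit_itv 0 1) => //.
exact: (@filterS _ _ ae_unit_filter _ _ _ h).
Qed.

Lemma ae_unit_atom_filter : Filter ae_unit_atom.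
Proof.
have FF := ae_unit_filter.
split.
- by split=> //; exact: (@filterT _ _ FF).
- by move=> P Q [P1 P2] [Q1 Q2]; split; [exact: (@filterI _ _ FF)|].
- by move=> P Q PQ [P1 P2]; split; [exact: (@filterS _ _ FF P)|exact: PQ].
Qed.

Lemma ae_unit_atom_bigcap (P : (set X)^nat) :
  (forall n, ae_unit_atom (P n)) -> ae_unit_atom (\bigcap_n P n).
Proof.
move=> h; split; first by apply: ae_unit_bigcap => n; case: (h n).
by move=> n _; case: (h n).
Qed.

Lemma ae_unit_atom_proper : ~ ae_unit_atom set0.
Proof. by case. Qed.

End unit_interval_filters.

Section measurable_derivative.
Context (R : realType).
Notation mu := (@lebesgue_measure R).
Notation X := (measurableTypeR R).
Implicit Types (f g : Lip01 R) (u v : X -> R).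
Notation F := (@ae_unit R).

Let FF : Filter F := @ae_unit_filter R.
Let aeS := @filterS X F FF.
Let aeS2 := @filterS2 X F FF.
Let aeS3 := @filterS3 X F FF.

Let ex_der f : exists w : X -> R, measurable_fun setT w /\
  eqae F (lip_deriv f) w.
Proof. by have [w mw fw] := lip_deriv_measurable f; exists w. Qed.

(** A measurable function equal to the derivative almost everywhere on [0, 1]. *)
Definition der f : X -> R := projT1 (cid (ex_der f)).

Lemma measurable_der f : measurable_fun setT (der f).
Proof. by rewrite /der; case: cid => w []. Qed.

Lemma lip_derivE f : eqae F (lip_deriv f) (der f).
Proof. by rewrite /der; case: cid => w []. Qed.

Lemma ess_bounded_der f : ess_bounded F (der f).
Proof.
split; first exact: measurable_der.
have [K fK] := lip_deriv_bounded f; exists K.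
by move: (lip_derivE f) fK; apply: aeS2 => x /= ->.
Qed.

Lemma der_linear a f g : eqae F (der (a *: f + g)) (fun x => a * der f x + der g x).
Proof.
have := lip_deriv_linear a f g.
move: (aeS2 (fun x => @conj _ _) (lip_derivE f) (lip_derivE g))
  (lip_derivE (a *: f + g)).
by apply: aeS3 => x /= [-> ->] ->.
Qed.

Lemma derB f g : eqae F (der (f - g)) (fun x => der f x - der g x).
Proof.
have h := der_linear (-1) g f; rewrite scaleN1r addrC in h.
by apply: aeS h => x /= ->; rewrite mulN1r addrC.
Qed.

Lemma der0 : eqae F (der (0 : Lip01 R)) (cst 0).
Proof.
have := derB 0 (0 : Lip01 R).
by rewrite subrr; apply: aeS => x /= ->; rewrite subrr.
Qed.

Lemma der_inj f g : f 0 = g 0 -> eqae F (der f) (der g) -> f = g.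
Proof.
move=> fg dfg; apply: lip01_ext => //.
have := dfg; move: (lip_derivE f) (lip_derivE g).
by apply: aeS3 => x /= -> ->.
Qed.

Lemma ex_primitive (a : R) u : ess_bounded F u ->
  exists f, f 0 = a /\ eqae F (der f) u.
Proof.
move=> [mu' [c uc]]; have [f [f0 fu]] := lip01_primitive a mu' uc.
exists f; split => //; move: (lip_derivE f) fu.
by apply: aeS2 => x /= ->.
Qed.

Lemma lip_leE f g :
  lip_le f g <-> f 0 <= g 0 /\ F [set x | der f x <= der g x].
Proof.
by rewrite /lip_le; split=> -[-> h]; split => //; move: (lip_derivE f) (lip_derivE g) h;
  apply: aeS3 => x /= -> ->.
Qed.

Lemma deriv_normP f c : deriv_norm f <= c <-> F [set x | `|der f x| <= c].
Proof.
have E : F [set x | `|lip_deriv f x| <= c] <-> F [set x | `|der f x| <= c].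
  by split; apply: aeS2 (lip_derivE f) => x /= ->.
have [c0|c0] := leP 0 c.
  by rewrite -E; exact: deriv_norm_le.
split=> h.
  by have := le_trans (deriv_norm_ge0 f) h; rewrite leNgt c0.
exfalso; apply: (@ae_unit_proper R); apply: aeS h => x /= h.
by have := le_trans (normr_ge0 _) h; rewrite leNgt c0.
Qed.

Lemma deriv_norm_eq f g :
  (forall c, F [set x | `|der f x| <= c] <-> F [set x | `|der g x| <= c]) ->
  deriv_norm f = deriv_norm g.
Proof.
move=> h; apply/eqP; rewrite eq_le; apply/andP; split.
  exact: (deriv_normP f _).2 ((h _).2 ((deriv_normP g _).1 (lexx _))).
exact: (deriv_normP g _).2 ((h _).1 ((deriv_normP f _).1 (lexx _))).
Qed.

Lemma lip01_linear_pack (G : Lip01 R -> Lip01 R) :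
  (forall a f g, G (a *: f + g) = a *: G f + G g) ->
  exists L : {linear Lip01 R -> Lip01 R}, L =1 G.
Proof.
move=> Glin.
pose M := GRing.isLinear.Build R (Lip01 R) (Lip01 R) *:%R G Glin.
by exists (HB.pack_for {linear Lip01 R -> Lip01 R} G M).
Qed.

End measurable_derivative.

(** * The case of a finite exponent *)

Section finite_exponent.
Context (R : realType).
Notation X := (measurableTypeR R).
Implicit Types (f g h : Lip01 R) (u v : X -> R).
Notation F := (@ae_unit R).

Let FF : Filter F := @ae_unit_filter R.
Let aeS := @filterS X F FF.
Let aeS2 := @filterS2 X F FF.
Let aeS3 := @filterS3 X F FF.

Variable r : R.
Hypothesis r1 : 1 <= r.

Let r0 : 0 < r. Proof. exact: lt_le_trans ltr01 r1. Qed.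

Let pow1 : 1 `^ r = 1 :> R. Proof. by rewrite powR1. Qed.

Let rn0 : r != 0. Proof. by rewrite gt_eqF. Qed.

Lemma powR_inj_ge0 (a b s : R) : 0 < s -> 0 <= a -> 0 <= b ->
  a `^ s = b `^ s -> a = b.
Proof.
move=> s0 a0 b0; exact: (powR_injective s0).
Qed.

(** The [r]-th power of the norm. *)
Definition norm_pow f : R := `|f 0| `^ r + deriv_norm f `^ r.

Lemma norm_pow_ge0 f : 0 <= norm_pow f.
Proof. by rewrite addr_ge0// powR_ge0. Qed.

Lemma lip_norm_inj f g :
  lip_norm r%:E f = lip_norm r%:E g <-> norm_pow f = norm_pow g.
Proof.
split=> [|fg]; last by rewrite /lip_norm -!/(norm_pow _) fg.
by apply: powR_inj_ge0; rewrite ?invr_gt0 ?norm_pow_ge0.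
Qed.

Lemma lip_norm_eq1 f : lip_norm r%:E f = 1 <-> norm_pow f = 1.
Proof.
split=> [|fg]; last by rewrite /lip_norm -!/(norm_pow _) fg powR1.
move=> f1; have {f1}: norm_pow f `^ r^-1 = 1 `^ r^-1 by rewrite powR1.
by apply: powR_inj_ge0; rewrite ?invr_gt0 ?norm_pow_ge0.
Qed.

Lemma norm_pow_dist f g : norm_pow (f - g) =
  `|f 0 - g 0| `^ r + deriv_norm (f - g) `^ r.
Proof. by []. Qed.

Lemma pos_sphereE f : pos_sphere r%:E f <->
  [/\ norm_pow f = 1, 0 <= f 0 & F [set x | 0 <= der f x]].
Proof.
have E : lip_le 0 f <-> 0 <= f 0 /\ F [set x | 0 <= der f x].
  rewrite lip_leE; split=> -[-> h]; split=> //; move: (der0 R) h.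
    by apply: aeS2 => x /= ->.
  by apply: aeS2 => x /= ->.
by split=> [[/lip_norm_eq1 ? /E[]]|[/lip_norm_eq1 ? ? ?]]; split=> //; apply/E.
Qed.

Let pow_le1 (a b : R) : 0 <= a -> 0 <= b -> a `^ r + b `^ r = 1 -> a <= 1.
Proof.
move=> a0 b0 ab; rewrite leNgt; apply/negP => a1.
have := gt0_ltr_powR r0 _ _ a1; rewrite !nnegrE ler01 a0 powR1 => /(_ isT isT).
by have := powR_ge0 b r; lra.
Qed.

Lemma pos_sphere_bounds f : pos_sphere r%:E f ->
  [/\ 0 <= f 0 <= 1, deriv_norm f <= 1, F [set x | 0 <= der f x <= 1] &
      f 0 `^ r + deriv_norm f `^ r = 1].
Proof.
move=> /pos_sphereE[N1 f0 df0].
have E : f 0 `^ r + deriv_norm f `^ r = 1 by rewrite -N1 /norm_pow ger0_norm.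
have d1 : deriv_norm f <= 1.
  by apply: (@pow_le1 _ (f 0)) => //; [exact: deriv_norm_ge0|rewrite addrC].
split=> //.
  by rewrite f0/=; apply: (pow_le1 f0 (deriv_norm_ge0 f)).
have := (deriv_normP f 1).1 d1; apply: aeS2 df0 => x /= -> /=.
exact: ler_normlW.
Qed.

Lemma deriv_norm_nneg f c : F [set x | 0 <= der f x] ->
  deriv_norm f <= c <-> F [set x | der f x <= c].
Proof.
move=> df0; rewrite deriv_normP; split; apply: aeS2 df0 => x /= f0 h.
  exact: ler_normlW.
by rewrite ger0_norm.
Qed.

Lemma deriv_norm_sub_le1 f g : pos_sphere r%:E f -> pos_sphere r%:E g ->
  deriv_norm (f - g) <= 1.
Proof.
move=> /pos_sphere_bounds[_ _ f01 _] /pos_sphere_bounds[_ _ g01 _].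
apply: (deriv_normP _ _).2; move: (derB f g) f01 g01; apply: aeS3 => x /= h.
rewrite h => {h}; move: (der f x) (der g x) => y z.
by rewrite ler_norml; lra.
Qed.

Lemma deriv_norm_eq0 f : deriv_norm f = 0 -> eqae F (der f) (cst 0).
Proof.
move=> f0; have : deriv_norm f <= 0 by rewrite f0.
by move=> /deriv_normP; apply: aeS => x /=; rewrite normr_le0 => /eqP.
Qed.

Lemma norm_pow_eq0 f : norm_pow f = 0 -> f = 0.
Proof.
move=> /eqP; rewrite /norm_pow paddr_eq0 ?powR_ge0//.
rewrite !powR_eq0 rn0 !andbT normr_eq0 => /andP[/eqP f0 /eqP d0].
apply: der_inj => //; apply: (eqae_trans FF (deriv_norm_eq0 d0)).
exact: eqaeC (der0 R).
Qed.

Lemma deriv_norm_eq_der f g : eqae F (der f) (der g) ->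
  deriv_norm f = deriv_norm g.
Proof.
by move=> fg; apply: deriv_norm_eq => c; split; apply: aeS2 fg => x /= ->.
Qed.

Lemma deriv_normN f g : eqae F (der f) (fun x => - der g x) ->
  deriv_norm f = deriv_norm g.
Proof.
by move=> fg; apply: deriv_norm_eq => c; split; apply: aeS2 fg => x /= ->;
  rewrite normrN.
Qed.

Lemma plus_sphere_der f : pos_sphere r%:E f -> f 0 = 0 ->
  plus_sphere F (der f).
Proof.
move=> pf f0; have [_ d1 f01 E] := pos_sphere_bounds pf.
have d1' : deriv_norm f = 1.
  apply: (powR_inj_ge0 r0) => //; first exact: deriv_norm_ge0.
  by move: E; rewrite f0 powR0// add0r powR1.
split; [exact: measurable_der|exact: f01|move=> c fc].
rewrite -d1'; apply: (deriv_norm_nneg _ _).2 => //.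
by apply: aeS f01 => x /= /andP[].
Qed.

Lemma pos_sphere_primitive f u : plus_sphere F u -> f 0 = 0 ->
  eqae F (der f) u -> pos_sphere r%:E f.
Proof.
move=> [_ u01 u1] f0 fu; apply/pos_sphereE.
have d1 : deriv_norm f = 1.
  apply/eqP; rewrite eq_le; apply/andP; split.
    apply: (deriv_normP _ _).2; apply: aeS2 fu u01 => x /= -> /andP[h0 h1].
    by rewrite ger0_norm.
  apply: u1; have := (deriv_normP f _).1 (lexx _); apply: aeS2 fu => x /= ->.
  exact: ler_normlW.
split; first by rewrite /norm_pow f0 d1 normr0 powR0// powR1 add0r.
  by rewrite f0.
by apply: aeS2 fu u01 => x /= -> /andP[].
Qed.

Lemma pos_sphere_at1 f : pos_sphere r%:E f -> f 0 = 1 ->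
  eqae F (der f) (cst 0).
Proof.
move=> /pos_sphere_bounds[_ _ _ E] f0; apply: deriv_norm_eq0.
move: E; rewrite f0 powR1 => E.
have : deriv_norm f `^ r = 0 by lra.
exact: powR_eq0_eq0.
Qed.

(** The [r]-th power of the diameter of the positive sphere is 2, and it is
    attained only if one function has value 1 at 0 (hence is constant) and the
    other one vanishes at 0. *)
Lemma pos_sphere_diameter f g : pos_sphere r%:E f -> pos_sphere r%:E g ->
  norm_pow (f - g) = 2 -> (f 0 = 1 /\ g 0 = 0) \/ (f 0 = 0 /\ g 0 = 1).
Proof.
move=> pf pg; rewrite norm_pow_dist.
have d1 := deriv_norm_sub_le1 pf pg.
have [f01 _ _ _] := pos_sphere_bounds pf.
have [g01 _ _ _] := pos_sphere_bounds pg.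
have fg1 : `|f 0 - g 0| <= 1 by rewrite ler_norml; lra.
have h1 : deriv_norm (f - g) `^ r <= 1.
  rewrite -[leRHS]pow1.
  by apply: (ge0_ler_powR (ltW r0)); rewrite ?nnegrE ?deriv_norm_ge0.
have h2 : `|f 0 - g 0| `^ r <= 1.
  rewrite -[leRHS]pow1.
  by apply: (ge0_ler_powR (ltW r0)); rewrite ?nnegrE.
move=> E; have : `|f 0 - g 0| `^ r = 1 `^ r by rewrite powR1; lra.
move=> /(powR_inj_ge0 r0 (normr_ge0 _) ler01).
by have [?|?] := ger0P (f 0 - g 0) => ?; [left|right]; split; lra.
Qed.

Lemma one_sub_powR_decr (a b : R) : 0 <= a -> a < b -> b <= 1 ->
  (1 - b) `^ r + (1 - b `^ r) < (1 - a) `^ r + (1 - a `^ r).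
Proof.
move=> a0 ab b1.
have nneg (c : R) : 0 <= c -> c \is Num.nneg by rewrite nnegrE.
have b0 : 0 <= b := le_trans a0 (ltW ab).
have h1 := gt0_ltr_powR r0 (nneg _ a0) (nneg _ b0) ab.
have Cb0 : 0 <= 1 - b by rewrite subr_ge0.
have Ca0 : 0 <= 1 - a by rewrite subr_ge0 (le_trans (ltW ab)).
have Cab : 1 - b < 1 - a by rewrite ltrD2l ltrN2.
have h2 := gt0_ltr_powR r0 (nneg _ Cb0) (nneg _ Ca0) Cab.
by apply: ltrD => //; rewrite ltrD2l ltrN2.
Qed.

Section isometry.
Variable Delta : Lip01 R -> Lip01 R.
Hypothesis Delta_fun : set_fun (pos_sphere r%:E) (pos_sphere r%:E) Delta.
Hypothesis Delta_surj : set_surj (pos_sphere r%:E) (pos_sphere r%:E) Delta.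
Hypothesis Delta_isom : isometry_on r%:E (pos_sphere r%:E) Delta.

Let Delta_pow f g : pos_sphere r%:E f -> pos_sphere r%:E g ->
  norm_pow (Delta f - Delta g) = norm_pow (f - g).
Proof. by move=> pf pg; apply/lip_norm_inj; apply: Delta_isom; rewrite inE. Qed.

Let Delta_sphere f : pos_sphere r%:E f -> pos_sphere r%:E (Delta f).
Proof. by move=> pf; exact: Delta_fun. Qed.

Let ex_indic (A : set X) : nonnull F A ->
  exists f, [/\ pos_sphere r%:E f, f 0 = 0 & eqae F (der f) \1_A].
Proof.
move=> nA; have pA := plus_sphere_indic R FF nA.
have [f [f0 fA]] := ex_primitive 0 (plus_sphere_bounded FF pA).
by exists f; split=> //; exact: pos_sphere_primitive fA.
Qed.

(** The function 1 is fixed, being at the maximal distance from two different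
    points [j1] and [j2]: if its image vanished at 0, the images of [j1] and [j2]
    would both be the function 1. *)
Lemma Delta_one (o : Lip01 R) : o 0 = 1 -> eqae F (der o) (cst 0) ->
  pos_sphere r%:E o /\ Delta o = o.
Proof.
move=> o0 do0.
have dno : deriv_norm o = 0.
  apply/eqP; rewrite eq_le deriv_norm_ge0 andbT.
  by apply: (deriv_normP _ _).2; apply: aeS do0 => x /= ->; rewrite normr0.
have po : pos_sphere r%:E o.
  apply/pos_sphereE; split; last by apply: aeS do0 => x /= ->.
    by rewrite /norm_pow o0 dno normr1 powR1 powR0// addr0.
  by rewrite o0.
split=> //.
have nn a b : 0 <= a -> a < b -> b <= 1 -> nonnull F `[a, b]%classic.
  by move=> a0 ab b1; split; [exact: measurable_itv|exact: ae_unit_itv].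
have n1 : nonnull F `[0, 3^-1]%classic by apply: nn; lra.
have n2 : nonnull F `[2^-1, 1]%classic by apply: nn; lra.
have [j1 [p1 j10 j1E]] := ex_indic n1.
have [j2 [p2 j20 j2E]] := ex_indic n2.
have dist2 j : pos_sphere r%:E j -> j 0 = 0 -> norm_pow (o - j) = 2.
  move=> pj j0; have [_ _ _] := pos_sphere_bounds pj.
  rewrite j0 powR0// add0r => dj; rewrite norm_pow_dist o0 j0 subr0 normr1 powR1.
  rewrite (@deriv_normN _ j) ?dj//.
  by move: (derB o j) do0; apply: aeS2 => x /= -> ->; rewrite sub0r.
have D1 : norm_pow (Delta o - Delta j1) = 2 by rewrite Delta_pow ?dist2.
have D2 : norm_pow (Delta o - Delta j2) = 2 by rewrite Delta_pow ?dist2.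
have [[Do0 _]|[Do0 E1]] := pos_sphere_diameter (Delta_sphere po) (Delta_sphere p1) D1.
  apply: der_inj; first by rewrite Do0.
  apply: (eqae_trans FF (pos_sphere_at1 (Delta_sphere po) Do0)).
  exact: (eqaeC FF do0).
exfalso.
have [[Do0' _]|[_ E2]] := pos_sphere_diameter (Delta_sphere po) (Delta_sphere p2) D2.
  by move: Do0'; rewrite Do0 => /esym/eqP; rewrite oner_eq0.
have D12 : Delta j1 = Delta j2.
  apply: der_inj; first by rewrite E1.
  apply: (eqae_trans FF (pos_sphere_at1 (Delta_sphere p1) E1)).
  exact: (eqaeC FF (pos_sphere_at1 (Delta_sphere p2) E2)).
have : norm_pow (j1 - j2) = 0.
  rewrite -Delta_pow// D12 subrr /norm_pow normr0 powR0// add0r.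
  rewrite (_ : deriv_norm 0 = 0) ?powR0//.
  apply/eqP; rewrite eq_le deriv_norm_ge0 andbT.
  by apply: (deriv_normP _ _).2; apply: aeS (der0 R) => x /= ->; rewrite normr0.
move=> /norm_pow_eq0/eqP; rewrite subr_eq0 => /eqP j12.
have := j1E; rewrite j12 => k; have := eqae_trans FF (eqaeC FF k) j2E.
move=> /(nonnull_ex FF n1)[x [/= x1]].
rewrite indicT// indicF => [/eqP|/=]; first by rewrite oner_eq0.
move: x1; rewrite !in_itv/= => /andP[_ x3] /andP[x2 _].
have h23 : 3^-1 < 2^-1 :> R by rewrite ltf_pV2 ?posrE// ltr_nat.
by have := le_lt_trans (le_trans x2 x3) h23; rewrite ltxx.
Qed.

(** The value at 0 is a function of the distance to the function 1, by
    [one_sub_powR_decr]. *)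
Lemma Delta_at0 f : pos_sphere r%:E f -> (Delta f) 0 = f 0.
Proof.
move=> pf.
have [|o [ o0 do0]] := @ex_primitive R 1 (cst 0).
  by split=> //; exists 0; apply: aeS (@filterT _ _ FF) => x _ /=; rewrite normr0.
have [po Do] := Delta_one o0 do0.
have dist1 g : pos_sphere r%:E g ->
    norm_pow (g - o) = (1 - g 0) `^ r + (1 - g 0 `^ r) /\ 0 <= g 0 <= 1.
  move=> pg; have [g01 _ _ E] := pos_sphere_bounds pg; split=> //.
  rewrite norm_pow_dist o0 distrC ger0_norm; last by lra.
  have -> : deriv_norm (g - o) = deriv_norm g.
    apply: deriv_norm_eq_der; move: (derB g o) do0.
    by apply: aeS2 => x /= -> ->; rewrite subr0.
  by congr (_ + _); lra.
have [E1 f01] := dist1 _ pf.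
have [E2 Df01] := dist1 _ (Delta_sphere pf).
have : norm_pow (Delta f - o) = norm_pow (f - o) by rewrite -[in LHS]Do Delta_pow.
have mono := one_sub_powR_decr.
rewrite E1 E2 => E; apply/eqP; rewrite eq_le !leNgt.
move: f01 Df01 => /andP[f0 f1] /andP[Df0 Df1].
apply/andP; split; apply/negP => h.
  by have := mono _ _ f0 h Df1; rewrite E ltxx.
by have := mono _ _ Df0 h f1; rewrite E ltxx.
Qed.

Let deriv_norm_dist f g : pos_sphere r%:E f -> pos_sphere r%:E g ->
  deriv_norm (Delta f - Delta g) = deriv_norm (f - g).
Proof.
move=> pf pg.
apply: (powR_inj_ge0 r0 (deriv_norm_ge0 _) (deriv_norm_ge0 _)).
have := Delta_pow pf pg; rewrite 2!norm_pow_dist (Delta_at0 pf) (Delta_at0 pg).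
by move=> /addrI.
Qed.

Lemma deriv_norm_Delta f : pos_sphere r%:E f ->
  deriv_norm (Delta f) = deriv_norm f.
Proof.
move=> pf; apply: (powR_inj_ge0 r0 (deriv_norm_ge0 _) (deriv_norm_ge0 _)).
have [_ _ _ E1] := pos_sphere_bounds pf.
have [_ _ _] := pos_sphere_bounds (Delta_sphere pf).
by rewrite (Delta_at0 pf) -[in RHS]E1 => /addrI.
Qed.

Let dist_der f g c : deriv_norm (f - g) <= c <-> dist_le F (der f) (der g) c.
Proof.
split=> h.
  by have := (deriv_normP _ _).1 h; apply: aeS2 (derB f g) => x /= ->.
by apply: (deriv_normP _ _).2; move: (derB f g) h; apply: aeS2 => x /= ->.
Qed.

Theorem pos_sphere_extension_finite :
  exists L : {linear Lip01 R -> Lip01 R},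
    isometric_order_isomorphism r%:E L /\
    {in pos_sphere r%:E, L =1 Delta}.
Proof.
(* [I (a, u)] is the function with value [a] at 0 and derivative [u]. *)
have /choice[I hI] (au : R * (X -> R)) : exists f, ess_bounded F au.2 ->
    f 0 = au.1 /\ eqae F (der f) au.2.
  have [/(ex_primitive au.1)[f fu]|nu] := pselect (ess_bounded F au.2).
    by exists f.
  by exists 0.
have I0 a u : ess_bounded F u -> I (a, u) 0 = a by move=> /(hI (a, u))[].
have Id a u : ess_bounded F u -> eqae F (der (I (a, u))) u.
  by move=> /(hI (a, u))[].
have IK f : I (f 0, der f) = f.
  have bf := ess_bounded_der f.
  by apply: der_inj; [exact: I0|exact: Id].
have bS u : plus_sphere F u -> ess_bounded F u by exact: plus_sphere_bounded.
pose J u := I (0, u).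
have JS u : plus_sphere F u -> pos_sphere r%:E (J u).
  by move=> pu; apply: (pos_sphere_primitive pu); [exact/I0/bS|exact/Id/bS].
have J0 u : plus_sphere F u -> J u 0 = 0 by move=> pu; exact/I0/bS.
have Jd u : plus_sphere F u -> eqae F (der (J u)) u by move=> pu; exact/Id/bS.
pose D u := der (Delta (J u)).
have D_fun u : plus_sphere F u -> plus_sphere F (D u).
  move=> pu; apply: plus_sphere_der; first exact/Delta_sphere/JS.
  by rewrite Delta_at0 ?J0//; exact: JS.
have D_surj v : plus_sphere F v -> exists2 u, plus_sphere F u & eqae F (D u) v.
  move=> pv; have [f /= pf fv] := Delta_surj (JS _ pv).
  have f0 : f 0 = 0 by rewrite -Delta_at0// fv J0.
  exists (der f); first exact: plus_sphere_der.
  by rewrite /D /J -f0 IK fv; exact: Jd.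
have D_isom u v c : plus_sphere F u -> plus_sphere F v ->
    dist_le F u v c <-> dist_le F (D u) (D v) c.
  move=> pu pv; rewrite /D -dist_der deriv_norm_dist; try exact: JS.
  rewrite dist_der; split=> h.
    apply: (dist_le_eqaer FF (eqaeC FF (Jd _ pv))).
    exact: (dist_le_eqael FF (eqaeC FF (Jd _ pu))).
  apply: (dist_le_eqaer FF (Jd _ pv)).
  exact: (dist_le_eqael FF (Jd _ pu)).
have [T [Tb Teqae TD TZ [_ Tsurj Tle Tnorm Teq]]] := plus_sphere_isometry_extension FF
  (@ae_unit_bigcap R) (@ae_unit_proper R) D_fun D_surj D_isom.
have bE := @ess_bounded_der R.
pose G f := I (f 0, T (der f)).
have G0 f : G f 0 = f 0 by apply: I0; apply: Tb; exact: bE.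
have GE f : eqae F (der (G f)) (T (der f)).
  by apply: Id; apply: Tb; exact: bE.
have bZ a u := @ess_bounded_scale _ _ _ F FF u a.
have Glin a f g : G (a *: f + g) = a *: G f + G g.
  apply: der_inj; first by rewrite -[RHS]/(a * G f 0 + G g 0) !G0.
  apply: (eqae_trans FF (GE _)).
  have bl : ess_bounded F ((fun x => a * der f x) \+ der g).
    by apply: (ess_boundedD FF) => //; exact: bZ.
  apply: (eqae_trans FF (Teqae _ _ (bE _) bl (der_linear a f g))).
  apply: (eqae_trans FF (TD _ _ (bZ a _ (bE f)) (bE g))).
  apply: (eqae_trans FF _ (eqaeC FF (der_linear a (G f) (G g)))).
  move: (TZ a _ (bE f)) (GE f) (GE g); apply: aeS3 => x /= h1 h2 h3.
  by rewrite h1 h2 h3.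
have [L LG] := lip01_linear_pack Glin.
exists L; split; last first.
  move=> f; rewrite inE => pf; rewrite LG.
  have [_ _ f01 _] := pos_sphere_bounds pf.
  have [_ _ Df01 _] := pos_sphere_bounds (Delta_sphere pf).
  apply: der_inj; first by rewrite G0 Delta_at0.
  apply: (eqae_trans FF (GE _)).
  apply: (Teq _ _ (measurable_der f) f01 (measurable_der (Delta f)) Df01).
  - move=> c; have pos g : F [set x | 0 <= der g x <= 1] ->
        F [set x | 0 <= der g x].
      by apply: aeS => x /= /andP[].
    have h1 := deriv_norm_nneg c (pos _ f01).
    have := deriv_norm_nneg c (pos _ Df01).
    rewrite (deriv_norm_Delta pf) => h2.
    exact: (iff_trans (iff_sym h1) h2).
  - move=> g c pg.
    have fJ := dist_der f (J g) c.
    have DfJ := dist_der (Delta f) (Delta (J g)) c.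
    rewrite (deriv_norm_dist pf (JS _ pg)) in DfJ.
    split=> h.
      by apply: DfJ.1; apply: fJ.2; apply: (dist_le_eqaer FF (eqaeC FF (Jd _ pg))).
    by apply: (dist_le_eqaer FF (Jd _ pg)); apply: fJ.1; exact: DfJ.2.
split.
- move=> h _; have [u bu uh] := Tsurj _ (bE h).
  exists (I (h 0, u)) => //; rewrite LG; apply: der_inj; first by rewrite G0 I0.
  apply: (eqae_trans FF (GE _)); apply: (eqae_trans FF _ uh).
  by apply: Teqae => //; exact: Id.
- move=> f g _ _; rewrite -linearB LG; apply/lip_norm_inj.
  rewrite /norm_pow G0; congr (_ + _ `^ r).
  apply: deriv_norm_eq => c; split=> hc.
    apply: (Tnorm _ c (bE (f - g))).2.
    by move: (GE (f - g)) hc; apply: aeS2 => x /= ->.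
  by move: (GE (f - g)) ((Tnorm _ c (bE (f - g))).1 hc); apply: aeS2 => x /= ->.
- move=> f g; rewrite !LG; split=> h.
    have [h1 h2] := (lip_leE _ _).1 h; rewrite !G0 in h1.
    apply: (lip_leE f g).2; split; first exact: h1.
    apply: (Tle _ _ (bE f) (bE g)).2.
    move: (GE f) (GE g) h2; apply: aeS3 => x /= k1 k2.
    by rewrite k1 k2.
  have [h1 h2] := (lip_leE _ _).1 h.
  apply: (lip_leE (G f) (G g)).2; rewrite !G0; split; first exact: h1.
  move: (GE f) (GE g) ((Tle _ _ (bE f) (bE g)).1 h2); apply: aeS3 => x /= k1 k2.
  by rewrite k1 k2.
Qed.

End isometry.

End finite_exponent.

(** * The case of the exponent +oo *)

Section supremum_norm.
Context (R : realType).
Notation X := (measurableTypeR R).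
Implicit Types (f g : Lip01 R) (u v : X -> R).
Notation F := (@ae_unit_atom R).

Let FF : Filter F := @ae_unit_atom_filter R.
Let aeS := @filterS X F FF.
Let aeS2 := @filterS2 X F FF.
Let aeS3 := @filterS3 X F FF.

(** The derivative of [f] on [0, 1] together with [f 0], stored at -1. *)
Definition ext_der f : X -> R :=
  fun x => der f x + (f 0 - der f (-1)) * \1_[set -1] x.

Lemma ext_der_atom f : ext_der f (-1) = f 0.
Proof. by rewrite /ext_der indicT//= mulr1 addrC subrK. Qed.

Lemma ext_der_unit f x : x \in `[0, 1] -> ext_der f x = der f x.
Proof.
rewrite in_itv/= => /andP[x0 _]; rewrite /ext_der indicF ?mulr0 ?addr0//=.
by move=> xE; move: x0; rewrite xE; lra.
Qed.

Lemma measurable_ext_der f : measurable_fun setT (ext_der f).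
Proof.
apply: measurable_funD; first exact: measurable_der.
by apply: measurable_funM => //; apply: measurable_indic.
Qed.

Lemma ext_derP f (P : R -> Prop) :
  F [set x | P (ext_der f x)] <-> P (f 0) /\ ae_unit [set x | P (der f x)].
Proof.
rewrite /ae_unit_atom /= ext_der_atom.
split=> -[h1 h2]; split => //.
  by apply: (@filterS _ _ (@ae_filter_ringOfSetsType _ X R _)) h1 => x /= h x01;
    rewrite -ext_der_unit//; exact: h.
by apply: (@filterS _ _ (@ae_filter_ringOfSetsType _ X R _)) h2 => x /= h x01;
  rewrite ext_der_unit//; exact: h.
Qed.

Lemma ext_derP2 f g (P : R -> R -> Prop) :
  F [set x | P (ext_der f x) (ext_der g x)] <->
  P (f 0) (g 0) /\ ae_unit [set x | P (der f x) (der g x)].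
Proof.
rewrite /ae_unit_atom /= !ext_der_atom.
split=> -[h1 h2]; split => //.
  by apply: (@filterS _ _ (@ae_filter_ringOfSetsType _ X R _)) h1 => x /= h x01;
    rewrite -!ext_der_unit//; exact: h.
by apply: (@filterS _ _ (@ae_filter_ringOfSetsType _ X R _)) h2 => x /= h x01;
  rewrite !ext_der_unit//; exact: h.
Qed.

Lemma ext_der_linear a f g :
  eqae F (ext_der (a *: f + g)) (fun x => a * ext_der f x + ext_der g x).
Proof.
rewrite /eqae /ae_unit_atom /= !ext_der_atom; split=> //.
apply: (@filterS _ _ (@ae_filter_ringOfSetsType _ X R _)) (der_linear a f g).
by move=> x /= h x01; rewrite !ext_der_unit//; exact: h.
Qed.

Lemma ext_derB f g : eqae F (ext_der (f - g)) (fun x => ext_der f x - ext_der g x).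
Proof.
have := ext_der_linear (-1) g f; rewrite scaleN1r addrC.
by apply: aeS => x /= ->; rewrite mulN1r addrC.
Qed.

Lemma ext_der_inj f g : eqae F (ext_der f) (ext_der g) -> f = g.
Proof. by move=> /ext_derP2[h1 h2]; exact: der_inj. Qed.

Lemma ess_bounded_ext_der f : ess_bounded F (ext_der f).
Proof.
split; first exact: measurable_ext_der.
have [_ [K fK]] := ess_bounded_der f.
exists (Num.max K `|f 0|).
apply/(ext_derP f (fun y => `|y| <= Num.max K `|f 0|)).
rewrite le_max lexx orbT; split=> //.
by apply: (@filterS _ _ (@ae_unit_filter R)) fK => x /= h; rewrite le_max h.
Qed.

Lemma ex_ext_primitive u : ess_bounded F u -> exists f, eqae F (ext_der f) u.
Proof.
move=> [mu [c [uc _]]]; have [|f [f0 fu]] := @ex_primitive R (u (-1)) u.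
  by split=> //; exists c.
exists f; rewrite /eqae /ae_unit_atom /= ext_der_atom; split=> //.
apply: (@filterS _ _ (@ae_filter_ringOfSetsType _ X R _)) fu.
by move=> x /= h x01; rewrite ext_der_unit//; exact: h.
Qed.

Lemma lip_le_ext_der f g :
  lip_le f g <-> F [set x | ext_der f x <= ext_der g x].
Proof. by rewrite lip_leE (ext_derP2 f g (fun x y => x <= y)). Qed.

Lemma lip_norm_ext_der f c :
  lip_norm +oo%E f <= c <-> F [set x | `|ext_der f x| <= c].
Proof.
rewrite (ext_derP f (fun y => `|y| <= c)) /lip_norm ge_max.
by split=> [/andP[-> /deriv_normP]//|[-> h]]; apply/deriv_normP.
Qed.

Lemma lip_norm_dist f g c :
  lip_norm +oo%E (f - g) <= c <-> dist_le F (ext_der f) (ext_der g) c.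
Proof.
rewrite lip_norm_ext_der; split; apply: aeS2 (ext_derB f g) => x /= ->//.
Qed.

Lemma ext_der0 : eqae F (ext_der (0 : Lip01 R)) (cst 0).
Proof.
have := ext_derB 0 (0 : Lip01 R).
by rewrite subrr; apply: aeS => x /= ->; rewrite subrr.
Qed.

Lemma pos_sphere_ext_der f : pos_sphere +oo%E f <-> plus_sphere F (ext_der f).
Proof.
split=> [[f1 /lip_le_ext_der f0]|[_ f01 f1]].
  have {}f0 : F [set x | 0 <= ext_der f x].
    by apply: aeS2 f0 ext_der0 => x /= h1 h2; move: h1; rewrite h2.
  split; first exact: measurable_ext_der.
    have : F [set x | `|ext_der f x| <= 1] by apply/lip_norm_ext_der; rewrite f1.
    by apply: aeS2 f0 => x /= -> /ler_normlW ->.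
  move=> c fc; rewrite -f1; apply/lip_norm_ext_der.
  by apply: aeS2 f0 fc => x /= f0 fc; rewrite ger0_norm.
split; last first.
  apply/lip_le_ext_der; apply: aeS2 ext_der0 f01 => x /= -> /andP[-> _].
  by [].
apply/eqP; rewrite eq_le; apply/andP; split.
  apply/lip_norm_ext_der; apply: aeS f01 => x /= /andP[h0 h1].
  by rewrite ger0_norm.
apply: f1; have /lip_norm_ext_der := lexx (lip_norm +oo%E f).
by apply: aeS => x /=; exact: ler_normlW.
Qed.

Lemma plus_sphere_eqae u v : measurable_fun setT v -> eqae F u v ->
  plus_sphere F u -> plus_sphere F v.
Proof.
move=> mv uv [_ u01 u1]; split=> //.
  by apply: aeS2 uv u01 => x /= ->.
by move=> c vc; apply: u1; apply: aeS2 uv vc => x /= ->.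
Qed.

Theorem pos_sphere_extension_pinfty (Delta : Lip01 R -> Lip01 R)
    (Delta_fun : set_fun (pos_sphere +oo%E) (pos_sphere +oo%E) Delta)
    (Delta_surj : set_surj (pos_sphere +oo%E) (pos_sphere +oo%E) Delta)
    (Delta_isom : isometry_on +oo%E (pos_sphere +oo%E) Delta) :
  exists L : {linear Lip01 R -> Lip01 R},
    isometric_order_isomorphism +oo%E L /\
    {in pos_sphere +oo%E, L =1 Delta}.
Proof.
(* [I] is the inverse of [ext_der]. *)
have /choice[I hI] u : exists f, ess_bounded F u -> eqae F (ext_der f) u.
  have [/ex_ext_primitive[f fu]|nu] := pselect (ess_bounded F u); first by exists f.
  by exists 0.
have IK f : I (ext_der f) = f.
  by apply: ext_der_inj; apply: hI; exact: ess_bounded_ext_der.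
have bS u : plus_sphere F u -> ess_bounded F u by exact: plus_sphere_bounded.
have hIS u : plus_sphere F u -> eqae F (ext_der (I u)) u by move=> /bS/hI.
have IS u : plus_sphere F u -> pos_sphere +oo%E (I u).
  move=> pu; apply/pos_sphere_ext_der.
  apply: plus_sphere_eqae (pu); first exact: measurable_ext_der.
  by apply: (eqaeC FF); exact: hIS.
pose D u := ext_der (Delta (I u)).
have D_fun u : plus_sphere F u -> plus_sphere F (D u).
  by move=> pu; apply/pos_sphere_ext_der; apply: Delta_fun; exact: IS.
have D_surj v : plus_sphere F v -> exists2 u, plus_sphere F u & eqae F (D u) v.
  move=> pv; have [f /= pf fv] := Delta_surj _ (IS _ pv).
  exists (ext_der f); first exact/pos_sphere_ext_der.
  by rewrite /D IK fv; exact: hIS.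
have D_isom u v c : plus_sphere F u -> plus_sphere F v ->
    dist_le F u v c <-> dist_le F (D u) (D v) c.
  move=> pu pv; rewrite /D -lip_norm_dist Delta_isom ?inE; try exact: IS.
  rewrite lip_norm_dist; split=> h.
    apply: (dist_le_eqaer FF (eqaeC FF (hIS _ pv))).
    exact: (dist_le_eqael FF (eqaeC FF (hIS _ pu))).
  apply: (dist_le_eqaer FF (hIS _ pv)).
  exact: (dist_le_eqael FF (hIS _ pu)).
have [T [Tb Teqae TD TZ [TS Tsurj Tle Tnorm _]]] := plus_sphere_isometry_extension FF
  (@ae_unit_atom_bigcap R) (@ae_unit_atom_proper R) D_fun D_surj D_isom.
pose G f := I (T (ext_der f)).
have GE f : eqae F (ext_der (G f)) (T (ext_der f)).
  by apply: hI; apply: Tb; exact: ess_bounded_ext_der.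
have bE := ess_bounded_ext_der.
have bZ a u := @ess_bounded_scale _ _ _ F FF u a.
have Glin a f g : G (a *: f + g) = a *: G f + G g.
  apply: ext_der_inj; apply: (eqae_trans FF (GE _)).
  have bl : ess_bounded F ((fun x => a * ext_der f x) \+ ext_der g).
    by apply: (ess_boundedD FF) => //; exact: bZ.
  apply: (eqae_trans FF (Teqae _ _ (bE _) bl (ext_der_linear a f g))).
  apply: (eqae_trans FF (TD _ _ (bZ a _ (bE f)) (bE g))).
  apply: (eqae_trans FF _ (eqaeC FF (ext_der_linear a (G f) (G g)))).
  move: (TZ a _ (bE f)) (GE f) (GE g); apply: aeS3 => x /= h1 h2 h3.
  by rewrite h1 h2 h3.
have [L LG] := lip01_linear_pack Glin.
exists L; split; last first.
  move=> f; rewrite inE => pf; rewrite LG; apply: ext_der_inj.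
  apply: (eqae_trans FF (GE _)).
  have pEf : plus_sphere F (ext_der f) by exact/pos_sphere_ext_der.
  by have := TS _ pEf; rewrite /D IK.
split.
- move=> h _; have [u bu uh] := Tsurj _ (bE h).
  exists (I u) => //; rewrite LG; apply: ext_der_inj.
  apply: (eqae_trans FF (GE _)); apply: (eqae_trans FF _ uh).
  by apply: Teqae => //; exact: hI.
- move=> f g _ _; rewrite -linearB LG.
  have key h c : lip_norm +oo%E (G h) <= c <-> lip_norm +oo%E h <= c.
    split=> hc.
      apply: (lip_norm_ext_der h c).2; apply: (Tnorm _ c (bE h)).2.
      have := (lip_norm_ext_der (G h) c).1 hc.
      by apply: aeS2 (GE h) => x /= ->.
    apply: (lip_norm_ext_der (G h) c).2.
    have := (Tnorm _ c (bE h)).1 ((lip_norm_ext_der h c).1 hc).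
    by apply: aeS2 (GE h) => x /= ->.
  apply/eqP; rewrite eq_le; apply/andP; split; first exact: (key _ _).2.
  exact: (key _ _).1.
- move=> f g; rewrite !LG; split=> h.
    apply: (lip_le_ext_der f g).2; apply: (Tle _ _ (bE f) (bE g)).2.
    have := (lip_le_ext_der (G f) (G g)).1 h.
    move: (GE f) (GE g); apply: aeS3 => x /= h1 h2.
    by rewrite h1 h2.
  apply: (lip_le_ext_der (G f) (G g)).2.
  have := (Tle _ _ (bE f) (bE g)).1 ((lip_le_ext_der f g).1 h).
  move: (GE f) (GE g); apply: aeS3 => x /= h1 h2.
  by rewrite h1 h2.
Qed.

End supremum_norm.

(* [Delta] is a map on the positive sphere: only its values there matter. *)
Theorem corollary4p2 (R : realType) (p : \bar R) (hp : (1 <= p)%E)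
    (Delta : Lip01 R -> Lip01 R)
    (Delta_fun : set_fun (pos_sphere p) (pos_sphere p) Delta)
    (Delta_surj : set_surj (pos_sphere p) (pos_sphere p) Delta)
    (Delta_isom : isometry_on p (pos_sphere p) Delta) :
  exists F : {linear Lip01 R -> Lip01 R},
    isometric_order_isomorphism p F /\
    {in pos_sphere p, F =1 Delta}.
Proof.
case: p hp Delta_fun Delta_surj Delta_isom => [r| |] hp Dfun Dsurj Disom.
- exact: pos_sphere_extension_finite.
- exact: pos_sphere_extension_pinfty.
- by rewrite leeNy_eq in hp.
Qed.
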